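(* If a bipartite recurrent quiver $Q$ is Zamolodchikov integrable, then the associated bipartite bigraph $G(Q)$ is either (1) an admissible $ADE$ bigraph, or (2) an affine $\boxtimes$ finite $ADE$ bigraph.
   Context: A quiver $Q$ is a directed graph (multiple arrows allowed) without loops and without directed $2$-cycles. Mutation $\mu_v(Q)$ at a vertex $v$: (i) for each pair of arrows $u\to v$, $v\to w$ create an arrow $u\to w$; (ii) reverse all arrows adjacent to $v$; (iii) remove directed $2$-cycles, one after another, until none remain. A quiver is bipartite if its underlying graph is bipartite; a bipartition is then a map $\epsilon:\mathrm{Vert}(Q)\to\{0,1\}$, $v\mapsto\epsilon_v$, with $\epsilon_u\neq\epsilon_v$ for every arrow $u\to v$. Mutations at vertices not connected by an arrow commute, so one defines $\mu_\circ=\prod_{u:\epsilon_u=0}\mu_u$ and $\mu_\bullet=\prod_{v:\epsilon_v=1}\mu_v$. The bipartite quiver $Q$ is recurrent if $\mu_\circ(Q)=\mu_\bullet(Q)=Q^{\mathrm{op}}$, where $Q^{\mathrm{op}}$ is $Q$ with all arrows reversed. Let $\mathbf{x}=\{x_v\}_{v\in\mathrm{Vert}(Q)}$ be indeterminates and $\mathbb{Q}(\mathbf{x})$ the field of rational functions in them. The $T$-system of $Q$ is the family $T_v(t)\in\mathbb{Q}(\mathbf{x})$, defined for $v\in\mathrm{Vert}(Q)$ and $t\in\mathbb{Z}$ with $t+\epsilon_v$ even, determined by $T_v(\epsilon_v)=x_v$ and $T_v(t+1)T_v(t-1)=\prod_{u\to v}T_u(t)+\prod_{v\to w}T_w(t)$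 for all $v$ and all $t$ with $t+\epsilon_v$ odd (products over all arrows). $Q$ is Zamolodchikov integrable if for every vertex $v$ there exist an integer $N$ and elements $J_0,J_1,\dots,J_N\in\mathbb{Q}(\mathbf{x})$ with $J_0,J_N\neq0$ such that $\sum_{j=0}^N J_jT_v(t+2j)=0$ for all $t\in\mathbb{Z}$ with $t+\epsilon_v$ even. A bigraph is an ordered pair $(\Gamma,\Delta)$ of undirected graphs that share a common vertex set and share no edges; it is bipartite if the vertices can be $2$-colored so that every edge of $\Gamma$ or of $\Delta$ joins vertices of different colors. For a bipartite quiver $Q$ with bipartition $\epsilon$, $G(Q)=(\Gamma,\Delta)$ is the bipartite bigraph on $\mathrm{Vert}(Q)$ in which $\Gamma$ has an edge $(u,v)$ for each arrow $u\to v$ with $\epsilon_u=0,\epsilon_v=1$, and $\Delta$ has an edge $(u,v)$ for each arrow $u\to v$ with $\epsilon_u=1,\epsilon_v=0$. Finite $ADE$ Dynkin diagrams are those of type $A_n,D_n,E_6,E_7,E_8$. Affine $ADE$ Dynkin diagrams are the extended diagrams of type $\hat A_n,\hat D_n,\hat E_6,\hat E_7,\hat E_8$ ($\hat A_1$ is two vertices joined by a double edge; $\hat A_n$ for $n\ge2$ is a cycle with $n+1$ vertices). A bipartite bigraph $(\Gamma,\Delta)$ whose adjacency matrices $A_\Gamma,A_\Delta$ commute is called an admissible $ADE$ bigraph if all connected components of both $\Gamma$ and $\Delta$ are finite $ADE$ Dynkin diagrams, and an affine $\boxtimes$ finite $ADE$ bigraph if all connected components of $\Gamma$ are affine $ADE$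 Dynkin diagrams and all connected components of $\Delta$ are finite $ADE$ Dynkin diagrams.
   Formalization: The conclusion is proved for G(Q) formed with a suitable bipartition of Q (possibly recolored) and for each connected component separately; for a fixed bipartition or a disconnected Q the literal claim fails (Kronecker quiver with colors swapped; A_1 plus Kronecker). *)

(* Defs.v *)
From mathcomp Require Import all_boot all_order all_algebra.
From mathcomp Require Import mpoly.

Set Implicit Arguments.
Unset Strict Implicit.
Unset Printing Implicit Defensive.

Import GRing.Theory.
Local Open Scope ring_scope.

(* [mult G u v] is the number of edges joining [u] and [v]. *)
Record multigraph (V : finType) := Multigraph {
  mult :> V -> V -> nat;
  mult_sym : forall u v, mult u v = mult v u
}.

Definition adjacent (V : finType) (G : multigraph V) : rel V :=
  fun u v => (0 < G u v)%N.

Definition induced (V : finType) (C : {set V}) (G : multigraph V) :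
    multigraph {v : V | v \in C} :=
  @Multigraph {v : V | v \in C} (fun u v => G (val u) (val v))
    (fun u v => mult_sym G (val u) (val v)).

Definition component (V : finType) (G : multigraph V) (v : V) : {set V} :=
  [set w | connect (adjacent G) v w].

Definition all_components (P : forall V : finType, multigraph V -> Prop)
    (V : finType) (G : multigraph V) : Prop :=
  forall v : V, P _ (induced (component G v) G).

Definition isomorphic (V W : finType) (G : multigraph V) (H : multigraph W) :
    Prop :=
  exists2 f : V -> W, bijective f & forall u v, H (f u) (f v) = G u v.

Definition adjacency_matrix (V : finType) (G : multigraph V) : 'M[int]_#|V| :=
  \matrix_(i, j) (G (enum_val i) (enum_val j))%:Z.

Record bigraph (V : finType) := Bigraph {
  Gam : multigraph V;
  Del : multigraph V;
  no_shared_edge : forall u v, (Gam u v == 0%N) || (Del u v == 0%N)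
}.

Definition bipartite_bigraph (V : finType) (B : bigraph V) : Prop :=
  exists c : V -> bool,
    forall u v, adjacent (Gam B) u v || adjacent (Del B) u v -> c u != c v.

Lemma both_sym (V : finType) (B : bigraph V) u v :
  (Gam B u v + Del B u v = Gam B v u + Del B v u)%N.
Proof. by rewrite mult_sym [Del B u v]mult_sym. Qed.

Definition bigraph_union (V : finType) (B : bigraph V) : multigraph V :=
  Multigraph (both_sym B).

(* The connected component of [v] in [B] (that is, in the union of its two
   graphs), as a bigraph of its own. *)
Definition bigraph_component (V : finType) (B : bigraph V) (v : V) :
    bigraph {w : V | w \in component (bigraph_union B) v} :=
  let C := component (bigraph_union B) v in
  @Bigraph _ (induced C (Gam B)) (induced C (Del B))
    (fun u w => no_shared_edge B (val u) (val w)).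

Lemma edge_graph_sym n (s : seq (nat * nat)) (i j : 'I_n) :
  (count_mem (val i, val j) s + count_mem (val j, val i) s =
   count_mem (val j, val i) s + count_mem (val i, val j) s)%N.
Proof. exact: addnC. Qed.

(* Vertices 0, ..., n-1; the list [s] enumerates the edges, with repetitions
   for multiple edges. *)
Definition edge_graph n (s : seq (nat * nat)) : multigraph 'I_n :=
  Multigraph (@edge_graph_sym n s).

(* The edges of the path 0 - 1 - ... - (n-1). *)
Definition path_edges n : seq (nat * nat) := [seq (i, i.+1) | i <- iota 0 n.-1].

Definition dynkin_A n : multigraph 'I_n := edge_graph n (path_edges n).

Definition dynkin_D n : multigraph 'I_n :=
  edge_graph n ((n - 3, n.-1)%N :: path_edges n.-1).

(* The path 0 - ... - (n-2) with the extra vertex n-1 attached to 2. *)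
Definition dynkin_E n : multigraph 'I_n :=
  edge_graph n ((2, n.-1)%N :: path_edges n.-1).

(* The cycle with n+1 vertices; for n = 1 the list is (1,0), (0,1), which is
   the double edge. *)
Definition affine_A n : multigraph 'I_n.+1 :=
  edge_graph n.+1 ((n, 0)%N :: path_edges n.+1).

(* The path 0 - ... - (n-2) with n-1 attached to 1 and n attached to n-3. *)
Definition affine_D n : multigraph 'I_n.+1 :=
  edge_graph n.+1 [:: (1, n.-1)%N, (n - 3, n)%N & path_edges n.-1].

(* Trees with one trivalent vertex and arms of length (2,2,2), (3,3,1) and
   (2,5,1) respectively. *)
Definition affine_E6 : multigraph 'I_7 :=
  edge_graph 7 [:: (2, 5)%N, (5, 6)%N & path_edges 5].
Definition affine_E7 : multigraph 'I_8 :=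
  edge_graph 8 ((3, 7)%N :: path_edges 7).
Definition affine_E8 : multigraph 'I_9 :=
  edge_graph 9 ((2, 8)%N :: path_edges 8).

Variant finite_ADE (V : finType) (G : multigraph V) : Prop :=
  | FiniteA n of (1 <= n)%N & isomorphic G (dynkin_A n)
  | FiniteD n of (4 <= n)%N & isomorphic G (dynkin_D n)
  | FiniteE n of n \in [:: 6; 7; 8] & isomorphic G (dynkin_E n).

Variant affine_ADE (V : finType) (G : multigraph V) : Prop :=
  | AffineA n of (1 <= n)%N & isomorphic G (affine_A n)
  | AffineD n of (4 <= n)%N & isomorphic G (affine_D n)
  | AffineE6 of isomorphic G affine_E6
  | AffineE7 of isomorphic G affine_E7
  | AffineE8 of isomorphic G affine_E8.

Definition commuting_bigraph (V : finType) (B : bigraph V) : Prop :=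
  adjacency_matrix (Gam B) *m adjacency_matrix (Del B) =
  adjacency_matrix (Del B) *m adjacency_matrix (Gam B).

Definition admissible_ADE_bigraph (V : finType) (B : bigraph V) : Prop :=
  [/\ bipartite_bigraph B, commuting_bigraph B,
      all_components finite_ADE (Gam B) & all_components finite_ADE (Del B)].

Definition affine_finite_ADE_bigraph (V : finType) (B : bigraph V) : Prop :=
  [/\ bipartite_bigraph B, commuting_bigraph B,
      all_components affine_ADE (Gam B) & all_components finite_ADE (Del B)].

(* [arrows Q u v] is the number of arrows u -> v. *)
Record quiver (V : finType) := Quiver {
  arrows :> V -> V -> nat;
  no_loop : forall v, arrows v v = 0%N;
  no_2cycle : forall u v, (arrows u v == 0%N) || (arrows v u == 0%N)
}.

Section Mutation.
Variable V : finType.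
Implicit Types (a : V -> V -> nat) (v : V).

Definition add_paths v a : V -> V -> nat :=
  fun u w => (a u w + a u v * a v w)%N.

Definition reverse_at v a : V -> V -> nat :=
  fun u w => if (u == v) || (w == v) then a w u else a u w.

Lemma cancel_no_loop a v : (a v v - a v v = 0)%N.
Proof. exact: subnn. Qed.

Lemma cancel_no_2cycle a u v : (a u v - a v u == 0)%N || (a v u - a u v == 0)%N.
Proof. by rewrite !subn_eq0 leq_total. Qed.

(* Removing 2-cycles one after another leaves a(u,v) - a(v,u) arrows u -> v,
   with truncated subtraction. *)
Definition cancel_2cycles a : quiver V :=
  Quiver (cancel_no_loop a) (cancel_no_2cycle a).

Definition mutate v (Q : quiver V) : quiver V :=
  cancel_2cycles (reverse_at v (add_paths v Q)).

Definition opposite (Q : quiver V) : quiver V :=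
  @Quiver V (fun u w => Q w u) (no_loop Q) (fun u w => no_2cycle Q w u).

(* [false] and [true] stand for the colors 0 and 1. *)
Definition bipartition (Q : quiver V) (eps : V -> bool) : Prop :=
  forall u v, (0 < Q u v)%N -> eps u != eps v.

(* The product of the mutations at all vertices of color [b]. Since there are
   no arrows between them these mutations commute, so the order given by
   [enum V] is irrelevant. *)
Definition mutate_color (eps : V -> bool) (b : bool) (Q : quiver V) : quiver V :=
  foldr mutate Q [seq v <- enum V | eps v == b].

Definition recurrent (Q : quiver V) (eps : V -> bool) : Prop :=
  mutate_color eps false Q =2 opposite Q /\
  mutate_color eps true Q =2 opposite Q.

End Mutation.

Section QuiverBigraph.
Variables (V : finType) (Q : quiver V) (eps : V -> bool).

(* For [b = false] these arrows form Gamma, for [b = true] they form Delta. *)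
Definition arrows_from (b : bool) (u v : V) : nat :=
  if (eps u == b) && (eps v == ~~ b) then Q u v else 0%N.

Lemma arrows_from_sym b u v :
  (arrows_from b u v + arrows_from b v u =
   arrows_from b v u + arrows_from b u v)%N.
Proof. exact: addnC. Qed.

Definition edges_from (b : bool) : multigraph V := Multigraph (arrows_from_sym b).

Lemma edges_from_disjoint u v :
  (edges_from false u v == 0%N) || (edges_from true u v == 0%N).
Proof.
rewrite /= /arrows_from; case: (eps u) (eps v) => [] [] //=;
  by rewrite ?addn0 ?add0n // no_2cycle.
Qed.

Definition quiver_bigraph : bigraph V := Bigraph edges_from_disjoint.

End QuiverBigraph.

Definition ratfun (V : finType) : fieldType := {fraction {mpoly rat[#|V|]}}.

Definition indet (V : finType) (v : V) : ratfun V :=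
  tofrac ('X_(enum_rank v) : {mpoly rat[#|V|]}).

Definition even_at (V : finType) (eps : V -> bool) (v : V) (t : int) : bool :=
  (2 %| t + (eps v : nat)%:Z)%Z.

(* Only the values [T v t] with t + eps_v even are meaningful, and only those
   are constrained; note that t + eps_u is even in the products below whenever
   u is joined to v by an arrow and t + eps_v is odd. *)
Definition is_Tsystem (V : finType) (Q : quiver V) (eps : V -> bool)
    (T : V -> int -> ratfun V) : Prop :=
  (forall v, T v (eps v : nat)%:Z = indet v) /\
  (forall v t, ~~ even_at eps v t ->
     T v (t + 1) * T v (t - 1) =
       \prod_(u : V) T u t ^+ Q u v + \prod_(w : V) T w t ^+ Q v w).

(* The T-system is unique: its values are subtraction-free rational functions,
   hence nonzero, so that the recurrence can be solved in both directions. *)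
Definition Zamolodchikov_integrable (V : finType) (Q : quiver V)
    (eps : V -> bool) : Prop :=
  exists2 T : V -> int -> ratfun V, is_Tsystem Q eps T &
  forall v : V, exists (N : nat) (J : 'I_N.+1 -> ratfun V),
    [/\ J ord0 != 0, J ord_max != 0 &
        forall t : int, even_at eps v t ->
          \sum_(j < N.+1) J j * T v (t + 2 * (j : nat)%:Z) = 0].

(* Main.v *)
From mathcomp Require Import -(notations) mpoly.
From mathcomp Require Import all_boot all_order all_algebra.
From mathcomp Require Import zify ring lra.
From mathcomp Require Import boolp classical_sets reals topology normedtype.
From mathcomp Require Import sequences exp derive Rstruct.
Require Import Defs.

Set Implicit Arguments.
Unset Strict Implicit.
Unset Printing Implicit Defensive.

Import Order.TTheory GRing.Theory Num.Theory.
Local Open Scope ring_scope.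

(** Write [Gamma] and [Delta] for the two graphs of the quiver. In both graphs
    two neighbours have opposite colors, and the exchange relation at [v] reads
    T_v(t+1) T_v(t-1) = P + P', where [P] and [P'] are the products of the
    values at time [t] over the [Gamma]-neighbours and the [Delta]-neighbours
    of [v].

    Dynamics. Evaluate the T-system at a positive rational point [h] at which
    the leading coefficients of all the linear recurrences survive
    ([integrable_trajectory]). The values are positive, and the recurrences
    make their logarithms grow at most linearly in time
    ([recurrence_growth]). On the other hand, for 0 < l < 1 one has
    ln (P + P') >= l ln P + (1 - l) ln P' + H with a constant H > 0
    ([ln_add]). Pair this inequality with a nonnegative eigenvector [w] of the
    matrix l A_Gamma + (1 - l) A_Delta, of eigenvalue kappa. The resulting
    weighted sum S(t) of logarithms satisfies
    S(t+2) + S(t) >= kappa S(t+1) + c with c > 0, so that it grows at least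
    quadratically as soon as kappa >= 2 and S(1) >= S(0) >= 0
    ([convex_growth]); the last condition is met by taking the coordinates of
    [h] close to 1 at one color and large at the other. Hence no mixture of
    the two matrices has a nonnegative eigenvector with eigenvalue at least 2
    ([integrable_no_growth]). As the maximum of a Rayleigh quotient is attained
    at such an eigenvector ([perron]), every quadratic form
    l A_Gamma + (1 - l) A_Delta is strictly below twice the identity. Varying
    [l], the forms 2 - A_Gamma and 2 - A_Delta are positive semidefinite
    ([integrable_semidefinite]), and their kernels meet trivially
    ([integrable_no_common_null]).

    Graph theory. A connected_graph multigraph for which 2 - A is positive
    semidefinite is a Dynkin diagram, affine if the form has a kernel and finite
    otherwise ([semidefinite_classification]). The reason is that a positive
    kernel vector of a subgraph, extended by zero, is isotropic for the large
    graph, hence in its kernel; a nonnegative kernel vector of a connected_graph graph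
    cannot vanish at some vertices only, and so an affine diagram is never a proper
    subgraph ([null_subgraph_iso]). A graph containing no affine diagram is a
    path with at most one further vertex, as one sees on a longest path.

    Commutation. Recurrence forces A_Gamma A_Delta = A_Delta A_Gamma
    ([recurrent_commute]), so A_Delta preserves the kernel of 2 - A_Gamma.
    Whether the [Gamma]-component of a vertex is affine is therefore the same
    for all vertices of a connected_graph component of the bigraph
    ([on_null_transfer]), and likewise for [Delta]. Both cannot be affine: two
    commuting symmetric matrices with nonnegative kernel vectors that overlap
    have a common kernel vector ([common_eigenvector], [on_null_both]). What is
    left are the pairs (finite, finite), (affine, finite) and (finite, affine);
    exchanging the two colors on the components of the last kind gives the
    bipartition that is asked for. *)

(** * Symmetric operators on functions over a finite set *)

Section Weights.
Variables (F : realFieldType) (V : finType).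
Implicit Types (M : V -> V -> F) (f g : V -> F).

Definition act M f (v : V) : F := \sum_u M v u * f u.
Definition dot f g : F := \sum_v f v * g v.

Definition bounded_form M (c : F) : Prop :=
  forall f, dot f (act M f) <= c * dot f f.

Lemma dotC f g : dot f g = dot g f.
Proof. by apply: eq_bigr => v _; rewrite mulrC. Qed.

Lemma dot_act M f g : (forall u v, M u v = M v u) ->
  dot f (act M g) = dot (act M f) g.
Proof.
move=> symM; rewrite /dot /act.
under eq_bigr => v _ do rewrite big_distrr.
rewrite exchange_big /=; apply: eq_bigr => u _.
rewrite big_distrl /=; apply: eq_bigr => v _.
by rewrite symM mulrCA mulrA.
Qed.

Lemma actD M f g (c : F) v : act M (fun u => f u + c * g u) v = act M f v + c * act M g v.
Proof.
rewrite /act big_distrr -big_split /=; apply: eq_bigr => u _; ring.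
Qed.

Lemma dot_shift f g h k (c d : F) :
  dot (fun u => f u + c * g u) (fun u => h u + d * k u) =
  dot f h + c * dot g h + d * dot f k + c * d * dot g k.
Proof.
rewrite /dot !big_distrr -!big_split /=; apply: eq_bigr => u _; ring.
Qed.

Lemma dot_ge0 f : 0 <= dot f f.
Proof. by apply: sumr_ge0 => v _; rewrite -expr2 sqr_ge0. Qed.

Lemma dot_gt0 f : ~ (f =1 fun=> 0) -> 0 < dot f f.
Proof.
move=> nz; rewrite lt0r dot_ge0 andbT; apply/eqP => z; apply: nz => v.
have : f v * f v = 0.
  by apply: (psumr_eq0P _ z) => // u _; rewrite -expr2 sqr_ge0.
by move/eqP; rewrite mulf_eq0 orbb => /eqP.
Qed.

Lemma dot_delta f v : dot (fun u => (u == v)%:R) f = f v.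
Proof.
rewrite /dot (bigD1 v) //= eqxx mul1r big1 ?addr0 // => u /negPf ->.
by rewrite mul0r.
Qed.

(** First variation of the nonnegative form c - M at the isotropic vector [f]:
    its value at f + t g is linear in t up to a term of order t^2, so the
    linear coefficient vanishes for each coordinate vector [g]. *)
Lemma isotropic_eigen M c f : (forall u v, M u v = M v u) ->
  bounded_form M c -> c * dot f f <= dot f (act M f) ->
  forall v, act M f v = c * f v.
Proof.
move=> symM bM isof v.
set g : V -> F := fun u => (u == v)%:R.
set d := act M f v - c * f v.
set B := c * dot g g - dot g (act M g).
have B0 : 0 <= B by rewrite subr_ge0 bM.
have key t : 2 * t * d <= t ^+ 2 * B.
  have h1 : dot (fun u => f u + t * g u) (act M (fun u => f u + t * g u)) =
      dot f (act M f) + 2 * t * act M f v + t ^+ 2 * dot g (act M g).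
    rewrite -[LHS]/(\sum_u _) /=.
    transitivity (dot (fun u => f u + t * g u) (fun u => act M f u + t * act M g u)).
      by apply: eq_bigr => u _; rewrite actD.
    rewrite dot_shift (dot_act f g) // (dotC (act M f)) dot_delta; ring.
  have h2 : dot (fun u => f u + t * g u) (fun u => f u + t * g u) =
      dot f f + 2 * t * f v + t ^+ 2 * dot g g.
    rewrite dot_shift (dotC f g) dot_delta; ring.
  have := bM (fun u => f u + t * g u); rewrite h1 h2 /d /B.
  nra.
(* With t = d / (B + 1) the inequality reads 2 d^2 (B + 1) <= d^2 B, which
   forces d = 0; adding 1 to B avoids a division by zero. *)
have := key (d / (B + 1)).
have B1 : 0 < B + 1 by lra.
rewrite -(ler_pM2r (exprn_gt0 2 B1)).
have -> : 2 * (d / (B + 1)) * d * (B + 1) ^+ 2 = 2 * d ^+ 2 * (B + 1) by field; lra.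
have -> : (d / (B + 1)) ^+ 2 * B * (B + 1) ^+ 2 = d ^+ 2 * B by field; lra.
move=> h; have : d ^+ 2 = 0.
  have := sqr_ge0 d; nra.
by move/eqP; rewrite sqrf_eq0 subr_eq0 => /eqP.
Qed.

Lemma dot_abs f : dot (fun v => `|f v|) (fun v => `|f v|) = dot f f.
Proof. by apply: eq_bigr => v _; rewrite -normrM ger0_norm // -expr2 sqr_ge0. Qed.

Lemma dot_act_abs M f : (forall u v, 0 <= M u v) ->
  dot f (act M f) <= dot (fun v => `|f v|) (act M (fun v => `|f v|)).
Proof.
move=> M0; apply: ler_sum => v _.
rewrite (le_trans (ler_norm _)) // normrM ler_wpM2l ?normr_ge0 //.
rewrite (le_trans (ler_norm_sum _ _ _)) // ler_sum // => u _.
by rewrite normrM ger0_norm.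
Qed.

(** Taking absolute values does not decrease the form of a nonnegative matrix,
    so a maximizer may be assumed nonnegative. This replaces irreducibility in
    the usual Perron-Frobenius argument. *)
Lemma eigen_abs M c f : (forall u v, M u v = M v u) ->
  (forall u v, 0 <= M u v) -> bounded_form M c ->
  c * dot f f <= dot f (act M f) ->
  forall v, act M (fun u => `|f u|) v = c * `|f v|.
Proof.
move=> symM M0 bM isof; apply: isotropic_eigen => //.
by rewrite dot_abs (le_trans isof) // dot_act_abs.
Qed.

End Weights.

(** * Perron vectors *)

Section Perron.
Import numFieldNormedType.Exports.
Variables (F : realType) (V : finType).
Implicit Types (f : V -> F).

Lemma continuous_sum (T : topologicalType) (I : Type) (s : seq I) (g : I -> T -> F) :
  (forall i, continuous (g i)) -> continuous (fun x => \sum_(i <- s) g i x).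
Proof.
move=> cg; elim: s => [|i s IH].
  rewrite (_ : (fun x => _) = fun=> 0); first exact: cst_continuous.
  by apply/boolp.funext => x; rewrite big_nil.
rewrite (_ : (fun x => _) = (fun x => g i x + \sum_(j <- s) g j x)).
  by move=> x; apply: continuousD; [apply: cg | apply: IH].
by apply/boolp.funext => x; rewrite big_cons.
Qed.

Let vec (x : 'rV[F]_#|V|) (v : V) : F := x ord0 (enum_rank v).
Let row_of f : 'rV[F]_#|V| := \row_i f (enum_val i).

Lemma vecK f : vec (row_of f) =1 f.
Proof. by move=> v; rewrite /vec mxE enum_rankK. Qed.

Lemma eq_dot f f' g g' : f =1 f' -> g =1 g' -> dot f g = dot f' g'.
Proof. by move=> e1 e2; apply: eq_bigr => v _; rewrite e1 e2. Qed.

Lemma eq_act (M : V -> V -> F) f f' : f =1 f' -> act M f =1 act M f'.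
Proof. by move=> e v; apply: eq_bigr => u _; rewrite e. Qed.

Lemma vec_continuous v : continuous (fun x : 'rV[F]_#|V| => vec x v).
Proof. exact: coord_continuous. Qed.

Lemma dot_continuous (g g' : V -> 'rV[F]_#|V| -> F) :
  (forall v, continuous (g v)) -> (forall v, continuous (g' v)) ->
  continuous (fun x => dot (g^~ x) (g'^~ x)).
Proof. by move=> c c'; apply: continuous_sum => v x; apply: continuousM; [apply: c | apply: c']. Qed.

Lemma form_continuous (M : V -> V -> F) :
  continuous (fun x : 'rV[F]_#|V| => dot (vec x) (act M (vec x))).
Proof.
apply: dot_continuous; first exact: vec_continuous.
by move=> v; apply: continuous_sum => u x; apply: continuousM;
   [apply: cst_continuous | apply: vec_continuous].
Qed.

Lemma dotZ (a : F) f g : dot (fun v => a * f v) (fun v => a * g v) = a ^+ 2 * dot f g.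
Proof. by rewrite /dot mulr_sumr; apply: eq_bigr => v _; ring. Qed.

Lemma actZ M (a : F) f v : act M (fun u => a * f u) v = a * act M f v.
Proof. by rewrite /act mulr_sumr; apply: eq_bigr => u _; ring. Qed.

Lemma unit_sphere_compact : compact [set x : 'rV[F]_#|V| | dot (vec x) (vec x) = 1]%classic.
Proof.
apply: bounded_closed_compact.
  exists 1; split; first exact: num_real.
  move=> B B1 x /= x1; rewrite (le_trans _ (ltW B1)) //.
  rewrite [`|x|]mx_normrE; apply: bigmax_le => // -[i j] _ /=.
  rewrite ord1 -(expr_le1 (n := 2)) // real_normK ?num_real // -x1.
  rewrite /dot (bigD1 (enum_val j)) //= /vec enum_valK expr2 lerDl sumr_ge0 // => u _.
  by rewrite -expr2 sqr_ge0.
have -> : [set x : 'rV[F]_#|V| | dot (vec x) (vec x) = 1]%classic =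
  ((fun x => dot (vec x) (vec x)) @^-1` [set 1])%classic by [].
apply: preimage_closed; last exact: closed_eq.
by move=> x _; apply: dot_continuous; exact: vec_continuous.
Qed.

(** A maximizer of the form of [M] on the unit sphere, made nonnegative; the
    sphere is compact. *)
Theorem perron (M : V -> V -> F) (c : F) f :
  (forall u v, M u v = M v u) -> (forall u v, 0 <= M u v) ->
  ~ (f =1 fun=> 0) -> c * dot f f <= dot f (act M f) ->
  exists (kappa : F) (w : V -> F), [/\ c <= kappa, forall v, 0 <= w v,
    ~ (w =1 fun=> 0) & forall v, act M w v = kappa * w v].
Proof.
move=> symM M0 fn0 cf.
pose normalize g : V -> F := fun v => (Num.sqrt (dot g g))^-1 * g v.
have unit g : ~ (g =1 fun=> 0) -> dot (normalize g) (normalize g) = 1.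
  by move=> /dot_gt0 g0; rewrite dotZ exprVn sqr_sqrtr ?ltW // mulVf ?gt_eqF.
have formN g : ~ (g =1 fun=> 0) ->
    dot (normalize g) (act M (normalize g)) = dot g (act M g) / dot g g.
  move=> /dot_gt0 g0; rewrite (@eq_dot _ (normalize g) _ (fun v => (Num.sqrt (dot g g))^-1 * act M g v)) //.
    by rewrite dotZ exprVn sqr_sqrtr ?ltW // mulrC.
  by move=> v; rewrite actZ.
have [|x /set_mem x1 xmax] := @EVT_max_rV F _ (fun x => dot (vec x) (act M (vec x))) _ _ unit_sphere_compact
    (continuous_subspaceT (@form_continuous M)).
  by exists (row_of (normalize f)); rewrite /= (eq_dot (vecK _) (vecK _)) unit.
pose kappa := dot (vec x) (act M (vec x)).
have bM : bounded_form M kappa.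
  move=> g; have [g0|gn0] := pselect (g =1 fun=> 0).
    by rewrite /dot !big1 ?mulr0 // => v _; rewrite g0 mul0r.
  rewrite -ler_pdivrMr ?dot_gt0 // -formN //.
  have := xmax (row_of (normalize g)); rewrite (eq_dot (vecK _) (eq_act M (vecK _))); apply.
  by apply: mem_set; rewrite /= (eq_dot (vecK _) (vecK _)) unit.
exists kappa, (fun v => `|vec x v|); split.
- have := bM f; have := dot_gt0 fn0 => f0 /(le_trans cf).
  by rewrite ler_pM2r.
- by move=> v; apply: normr_ge0.
- move=> z; have : dot (vec x) (vec x) = 0.
    by apply: big1 => v _; move/eqP: (z v); rewrite normr_eq0 => /eqP ->; rewrite mul0r.
  by rewrite x1 => /eqP; rewrite oner_eq0.
- by apply: eigen_abs => //; rewrite x1 mulr1.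
Qed.

End Perron.

(** * Simultaneous eigenvectors of commuting operators *)

Section CommonEigenvector.
Variables (F : realFieldType) (V : finType).
Implicit Types (M N : V -> V -> F) (f g : V -> F).

Let row_of f : 'rV[F]_#|V| := \row_i f (enum_val i).
Let mx_of M : 'M[F]_#|V| := \matrix_(i, j) M (enum_val i) (enum_val j).

Lemma sum_enum_val (h : V -> F) : \sum_(i < #|V|) h (enum_val i) = \sum_v h v.
Proof. by rewrite [RHS](reindex (@enum_val V V)) //; apply/onW_bij/enum_val_bij. Qed.

Lemma row_of_act M f : (forall u v, M u v = M v u) -> row_of f *m mx_of M = row_of (act M f).
Proof.
move=> symM; apply/rowP => j; rewrite !mxE /act -sum_enum_val; apply: eq_bigr => i _.
by rewrite !mxE mulrC symM.
Qed.

(** Suppose N - c is injective on the eigenspace of [M], which it preserves.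
    Then it is surjective there, so f = (N - c) f' and
    <f, g> = <f', (N - c) g> = 0. *)
Lemma common_eigenvector M N (c : F) f g :
  (forall u v, M u v = M v u) -> (forall u v, N u v = N v u) ->
  (forall u v, \sum_w M u w * N w v = \sum_w N u w * M w v) ->
  (forall v, act M f v = c * f v) -> (forall v, act N g v = c * g v) ->
  dot f g != 0 ->
  exists2 h, ~ (h =1 fun=> 0) & forall v, act M h v = c * h v /\ act N h v = c * h v.
Proof.
move=> symM symN comm fM gN fg.
pose P := mx_of M - c%:M; pose R := mx_of N - c%:M.
have PR : P *m R = R *m P.
  rewrite /P /R !mulmxBl !mulmxBr (scalar_mxC c (mx_of N)) (scalar_mxC c (mx_of M)).
  have -> : mx_of M *m mx_of N = mx_of N *m mx_of M.
    apply/matrixP => i j; rewrite !mxE.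
    rewrite -[RHS]/(\sum_(k < #|V|) mx_of N i k * mx_of M k j).
    transitivity (\sum_w M (enum_val i) w * N w (enum_val j)).
      by rewrite -sum_enum_val; apply: eq_bigr => k _; rewrite !mxE.
    by rewrite comm -sum_enum_val; apply: eq_bigr => k _; rewrite !mxE.
  by rewrite !opprD !opprK !addrA; congr (_ + _); rewrite addrAC.
have rowP_ M' (h : V -> F) : (forall u v, M' u v = M' v u) ->
    row_of h *m (mx_of M' - c%:M) = 0 <-> forall v, act M' h v = c * h v.
  move=> symM'; rewrite mulmxBr row_of_act // mul_mx_scalar; split=> [/eqP|h0].
    rewrite subr_eq0 => /eqP /rowP e v; have := e (enum_rank v).
    by rewrite !mxE enum_rankK.
  by apply/eqP; rewrite subr_eq0; apply/eqP/rowP => i; rewrite !mxE h0.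
have XR : (kermx P *m R <= kermx P)%MS by apply/sub_kermxP; rewrite -mulmxA -PR mulmxA mulmx_ker mul0mx.
(* The rows of [kermx P] span the eigenspace of [M]; vectors are rows, and
   [R] acts on the right. *)
case: (eqVneq (kermx P :&: kermx R)%MS 0) => [cap0|capn0].
  have rk : \rank (kermx P *m R) = \rank (kermx P).
    by have := mxrank_mul_ker (kermx P) R; rewrite cap0 mxrank0 addn0.
  have XRX : (kermx P <= kermx P *m R)%MS by rewrite -(geq_leqif (mxrank_leqif_sup XR)) rk.
  have fX : (row_of f <= kermx P)%MS by apply/sub_kermxP/(rowP_ _ _ symM).
  have /submxP [y fy] := submx_trans fX XRX.
  have gR : row_of g *m R = 0 by apply/(rowP_ _ _ symN).
  have Rsym : R^T = R by apply/matrixP => i j; rewrite !mxE symN eq_sym.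
  have fg0 : row_of f *m (row_of g)^T = 0.
    rewrite fy -2!mulmxA (_ : R *m _ = 0) ?mulmx0 //.
    by rewrite -[R]Rsym -trmx_mul gR trmx0.
  case/eqP: fg; have /matrixP/(_ 0 0) := fg0; rewrite !mxE => <-.
  by rewrite /dot -sum_enum_val; apply: eq_bigr => i _; rewrite !mxE.
have /rowV0Pn [x xcap xn0] := capn0.
pose h v := x 0 (enum_rank v).
have xh : row_of h = x by apply/rowP => i; rewrite !mxE /h enum_valK.
move: xcap; rewrite sub_capmx -xh => /andP [/sub_kermxP xP /sub_kermxP xR].
exists h => [h0|v]; last by split; move: v; apply/rowP_.
by case/eqP: xn0; rewrite -xh; apply/rowP => i; rewrite !mxE h0.
Qed.

End CommonEigenvector.

(** * Null vectors of a multigraph *)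

Definition weight (F : realFieldType) (V : finType) (G : multigraph V) (u v : V) : F :=
  (G u v)%:R.

Lemma weight_sym (F : realFieldType) (V : finType) (G : multigraph V) u v :
  weight F G u v = weight F G v u.
Proof. by rewrite /weight mult_sym. Qed.

Section Connected.
Variables (F : realFieldType) (V : finType) (G : multigraph V).
Notation A := (act (weight F G)).

(** Positive semidefiniteness of twice the identity minus the adjacency
    matrix. *)
Definition semidefinite := bounded_form (weight F G) 2.
Definition null_vector (f : V -> F) := forall v, A f v = 2 * f v.
Definition connected_graph := forall u v, connect (adjacent G) u v.

Lemma adjacent_sym : symmetric (adjacent G).
Proof. by move=> u v; rewrite /adjacent mult_sym. Qed.

Lemma null_isotropic f : null_vector f -> dot f (A f) = 2 * dot f f.
Proof.
move=> nf; rewrite /dot big_distrr; apply: eq_bigr => v _ /=.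
by rewrite nf mulrCA.
Qed.

Lemma null_abs f : semidefinite -> null_vector f -> null_vector (fun v => `|f v|).
Proof.
move=> sG nf v; apply: eigen_abs => //; first exact: weight_sym.
by rewrite null_isotropic.
Qed.

(** At a zero of [f] the null equation says that a sum of nonnegative terms
    vanishes; so zeros spread to neighbours, and positivity does too. *)
Lemma null_spread f u v : null_vector f -> (forall w, 0 <= f w) ->
  adjacent G v u -> 0 < f v -> 0 < f u.
Proof.
move=> nf f0 auv fv; have := nf u; rewrite /act (bigD1 v) //=.
have h : 0 <= \sum_(i | i != v) weight F G u i * f i.
  by apply: sumr_ge0 => i _; rewrite mulr_ge0 ?ler0n.
have : 0 < weight F G u v * f v by rewrite mulr_gt0 // ltr0n mult_sym.
lra.
Qed.

Lemma null_pos f v : null_vector f -> connected_graph -> (forall w, 0 <= f w) ->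
  0 < f v -> forall u, 0 < f u.
Proof.
move=> nf cG f0 fv u; have /connectP [p pp ->] := cG v u.
elim: p v fv pp => //= w p IH v fv /andP [avw pp].
by apply: IH pp; apply: null_spread fv.
Qed.

(** A witness that the graph is of finite type; [strict_label_null] is its
    purpose. *)
Definition strict_label (y : V -> nat) :=
  [/\ forall v, (0 < y v)%N,
      forall v, (\sum_u G v u * y u <= 2 * y v)%N &
      exists v, (\sum_u G v u * y u < 2 * y v)%N].

(** The absolute value [a] of a nonzero null vector is null and, by
    connectedness, positive. Pairing [a] with A y - 2 y gives zero because [a]
    is null, and a negative number because of the strict inequality. *)
Lemma strict_label_null y f : strict_label y -> semidefinite -> connected_graph ->
  null_vector f -> f =1 (fun=> 0).
Proof.
move=> [y0 yle [v0 ylt]] sG cG nf v; apply/eqP/negPn/negP => fv.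
have na := null_abs sG nf; set a := (fun v => `|f v|) in na.
have apos u : 0 < a u.
  by apply: (null_pos (v := v)) => //= [w|]; rewrite /a ?normr_ge0 ?normr_gt0.
set z : V -> F := fun v => (y v)%:R.
have e1 : dot z (A a) = 2 * dot z a.
  rewrite /dot big_distrr; apply: eq_bigr => u _ /=; rewrite na; ring.
rewrite dot_act in e1; last exact: weight_sym.
have Az u : A z u = (\sum_w G u w * y w)%N%:R.
  by rewrite natr_sum; apply: eq_bigr => w _; rewrite natrM.
suff : dot (A z) a < 2 * dot z a by rewrite e1 ltxx.
have hle u : A z u * a u <= 2 * (z u * a u).
  by rewrite mulrA ler_wpM2r ?(ltW (apos u)) // Az /z -natrM ler_nat.
rewrite /dot big_distrr /= (bigD1 v0) //= [ltRHS](bigD1 v0) //=.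
apply: ltr_leD; last by apply: ler_sum => u _; apply: hle.
by rewrite mulrA ltr_pM2r // Az /z -natrM ltr_nat.
Qed.

(** Pushed forward and extended by zero, the label [d] satisfies
    <f, A f> >= 2 <f, f>, because [G] has at least the edges of [H]. So it is
    isotropic, hence null, hence positive everywhere: [phi] is onto. Comparing
    the null equations of [f] and [d] then leaves no room for further edges. *)
Lemma null_subgraph_iso (W : finType) (H : multigraph W) (phi : W -> V)
    (d : W -> nat) (w0 : W) :
  semidefinite -> connected_graph -> injective phi ->
  (forall i j, (H i j <= G (phi i) (phi j))%N) ->
  (forall i, (0 < d i)%N) -> (forall i, (\sum_j H i j * d j = 2 * d i)%N) ->
  isomorphic G H /\ exists2 f, null_vector f & forall v, 0 < f v.
Proof.
move=> sG cG phiI HG d0 dnull.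
pose f v : F := \sum_(i | phi i == v) (d i)%:R.
have push (E : V -> F) : \sum_v E v * f v = \sum_i E (phi i) * (d i)%:R.
  rewrite (partition_big phi predT) //=; apply: eq_bigr => v _.
  by rewrite /f big_distrr /=; apply: eq_bigr => i /eqP ->.
have f0 v : 0 <= f v by apply: sumr_ge0 => i _; apply: ler0n.
have fphi i : f (phi i) = (d i)%:R.
  rewrite /f (big_pred1 i) // => j; exact: (inj_eq phiI).
have Aphi i : A f (phi i) = (\sum_j G (phi i) (phi j) * d j)%N%:R.
  by rewrite /act push natr_sum; apply: eq_bigr => j _; rewrite natrM.
have nf : null_vector f.
  move=> v; apply: isotropic_eigen => //; first exact: weight_sym.
  rewrite dotC /dot !push big_distrr; apply: ler_sum => i _ /=.
  rewrite fphi mulrA ler_wpM2r ?ler0n // Aphi -natrM ler_nat -dnull.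
  by apply: leq_sum => j _; rewrite leq_mul2r HG orbT.
have fpos : forall v, 0 < f v.
  by apply: (null_pos (v := phi w0)) => //; rewrite fphi ltr0n.
split; last by exists f.
have surj v : exists i, phi i == v.
  apply/existsP; apply: contraLR (fpos v) => /existsPn h.
  by rewrite /f big1 ?ltxx // => i hi; move: (h i); rewrite hi.
have bij : bijective phi.
  exists (fun v => xchoose (surj v)).
    by move=> i; apply: phiI; apply/eqP/(xchooseP (surj _)).
  by move=> v; apply/eqP/(xchooseP (surj _)).
have eqG i j : H i j = G (phi i) (phi j).
  have /eqP := nf (phi i); rewrite Aphi fphi -natrM eqr_nat -dnull eq_sym => /eqP e.
  have hle j' : (H i j' * d j' <= G (phi i) (phi j') * d j')%N.
    by rewrite leq_mul2r HG orbT.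
  have /eqP : (H i j * d j = G (phi i) (phi j) * d j)%N.
    apply/eqP; rewrite eqn_leq hle /=.
    move: e; rewrite (bigD1 j) //= [X in _ = X](bigD1 j) //=.
    have : (\sum_(k | k != j) H i k * d k <= \sum_(k | k != j) G (phi i) (phi k) * d k)%N.
      by apply: leq_sum => k _; apply: hle.
    by lia.
  by rewrite eqn_pmul2r // => /eqP.
have [psi K1 K2] := bij.
by exists psi; [exists phi | move=> u v; rewrite eqG !K2].
Qed.

End Connected.

(** * Multigraphs given by edge lists *)

Local Open Scope nat_scope.

(** Phrased with lists rather than with a big operator, so that it evaluates by
    computation on the exceptional diagrams. *)
Definition edge_sum (es : seq (nat * nat)) (d : nat -> nat) (i : nat) : nat :=
  sumn [seq (p.1 == i) * d p.2 + (p.2 == i) * d p.1 | p <- es].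

Definition edges_below n (es : seq (nat * nat)) :=
  all (fun p => (p.1 < n) && (p.2 < n)) es.

Lemma sum_delta_nat n (P : nat) (d : nat -> nat) : P < n ->
  \sum_(j < n) (P == j) * d j = d P.
Proof.
move=> Pn; rewrite (bigD1 (Ordinal Pn)) //= eqxx mul1n big1 ?addn0 // => j.
by rewrite -val_eqE /= eq_sym => /negPf ->.
Qed.

Lemma edge_graph_sum n es (d : nat -> nat) (i : 'I_n) : edges_below n es ->
  \sum_(j < n) edge_graph n es i j * d j = edge_sum es d i.
Proof.
rewrite /edge_sum; elim: es => [|[a b] es IH] /=.
  by rewrite big1.
case/andP=> /andP [/= an bn] /IH <-.
rewrite -(sum_delta_nat d an) -(sum_delta_nat d bn) !big_distrr -!big_split /=.
apply: eq_bigr => j _; rewrite !xpair_eqE -!mulnb; lia.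
Qed.

Lemma path_edges_rcons m : path_edges m.+2 = rcons (path_edges m.+1) (m, m.+1).
Proof.
rewrite /path_edges; have -> : m.+2.-1 = m.+1.-1 + 1 by rewrite addn1.
by rewrite iotaD map_cat cats1 add0n.
Qed.

Lemma mem_path_edges m i j : ((i, j) \in path_edges m) = (j == i.+1) && (j < m).
Proof.
apply/mapP/andP => [[k] | [/eqP -> im]].
  by rewrite mem_iota /= add0n => km [-> ->]; rewrite eqxx; split => //; lia.
by exists i => //; rewrite mem_iota; lia.
Qed.

Lemma uniq_path_edges m : uniq (path_edges m).
Proof. by rewrite map_inj_uniq ?iota_uniq // => i j []. Qed.

Lemma edge_sum_path m d i : edge_sum (path_edges m) d i =
  (i.+1 < m) * d i.+1 + ((0 < i) && (i < m)) * d i.-1.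
Proof.
rewrite /edge_sum; elim: m => [|[|m] IH]; first by rewrite andbF.
  by rewrite /=; case: (i).
rewrite path_edges_rcons map_rcons sumn_rcons IH /=.
rewrite !ltnS; case: (ltngtP i m) => [im|mi|->].
- by rewrite (gtn_eqF (leqW im)) (leqW (ltnW im)); lia.
- case: (eqVneq m.+1 i) => [<-|n1]; first by rewrite /= leqnn; lia.
  have -> : (i <= m.+1) = false by lia.
  by rewrite !andbF.
- by rewrite (gtn_eqF (ltnSn m)) leqnSn; lia.
Qed.

Lemma edge_sum_cons p es d i :
  edge_sum (p :: es) d i = (p.1 == i) * d p.2 + (p.2 == i) * d p.1 + edge_sum es d i.
Proof. by []. Qed.

(** * Dynkin diagrams inside semidefinite multigraphs *)

Section Embedding.
Variables (F : realFieldType) (V : finType) (G : multigraph V).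
Hypotheses (sG : semidefinite F G) (cG : connected_graph G).
Variable x0 : V.

Definition positive_null := exists2 f : V -> F, null_vector G f & forall v, (0 < f v)%R.

(** The criterion used to recognize each affine diagram: the vertices of [e]
    carry at least its edges, and [d] is its null label. *)
Lemma null_edges_iso n es (d : nat -> nat) (e : seq V) :
  size e = n -> 0 < n -> uniq e -> edges_below n es ->
  uniq es -> (forall i j, (i, j) \in es -> (j, i) \notin es) ->
  (forall i j, (i, j) \in es -> adjacent G (nth x0 e i) (nth x0 e j)) ->
  (forall i, i < n -> 0 < d i) ->
  (forall i, i < n -> edge_sum es d i = 2 * d i) ->
  isomorphic G (edge_graph n es) /\ positive_null.
Proof.
move=> se n0 ue bes ues asym adj dpos dnull.
apply: (null_subgraph_iso (phi := fun i : 'I_n => nth x0 e i) (d := fun i => d i)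
  (Ordinal n0) sG cG).
- by move=> i j /eqP; rewrite nth_uniq ?se // => /eqP /val_inj.
- move=> i j /=; rewrite !count_uniq_mem //.
  have [ij|_] := boolP (_ \in es).
    by rewrite (negPf (asym _ _ ij)); apply: adj ij.
  have [ji|//] := boolP (_ \in es).
  by rewrite mult_sym; apply: adj ji.
- by move=> i; apply: dpos.
- by move=> i; rewrite edge_graph_sum // dnull.
Qed.

(** A path in the graph, given by the list of its distinct vertices. *)
Definition chain (s : seq V) := uniq s && sorted (adjacent G) s.

Lemma chain_adj s i : chain s -> i.+1 < size s -> adjacent G (nth x0 s i) (nth x0 s i.+1).
Proof. by case/andP=> _ /(sortedP x0); apply. Qed.

Lemma chain_segment s a b : chain s -> chain (take b (drop a s)).
Proof.
case/andP=> us ss; apply/andP; split; first by rewrite take_uniq ?drop_uniq.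
by rewrite take_sorted ?drop_sorted.
Qed.

Lemma chain_rev s : chain s -> chain (rev s).
Proof.
case/andP=> us ss; rewrite /chain rev_uniq us rev_sorted /=.
by rewrite (eq_sorted (e' := adjacent G)) // => u v; rewrite adjacent_sym.
Qed.

Lemma path_edges_adj s t i j : chain s -> (i, j) \in path_edges (size s) ->
  adjacent G (nth x0 (s ++ t) i) (nth x0 (s ++ t) j).
Proof.
move=> cs; rewrite mem_path_edges => /andP [/eqP -> js].
by rewrite !nth_cat js (ltn_trans _ js) //; apply: chain_adj.
Qed.

Lemma affine_A_cycle s : chain s -> 3 <= size s ->
  adjacent G (nth x0 s 0) (nth x0 s (size s).-1) ->
  affine_ADE G /\ positive_null.
Proof.
move=> cs m3 a0.
have [] := @null_edges_iso (size s) (((size s).-1, 0) :: path_edges (size s)) (fun=> 1) s.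
- by [].
- lia.
- by case/andP: cs.
- apply/allP => -[i j]; rewrite inE => /orP [/eqP [-> ->] /=|]; first lia.
  by rewrite mem_path_edges /=; lia.
- by rewrite /= uniq_path_edges mem_path_edges; lia.
- by move=> i j; rewrite !inE !xpair_eqE !mem_path_edges; lia.
- move=> i j; rewrite inE => /orP [/eqP [-> ->]|]; first by rewrite adjacent_sym.
  by rewrite -{2 3}[s]cats0; apply: path_edges_adj.
- by [].
- by move=> i il; rewrite edge_sum_cons edge_sum_path /=; lia.
move=> iso pn; split=> //; apply: (@AffineA _ _ (size s).-1); first lia.
by move: iso; rewrite /affine_A prednK //; lia.
Qed.

Lemma affine_A_double u v : u != v -> 2 <= G u v -> affine_ADE G /\ positive_null.
Proof.
move=> uv G2.
have [] := @null_subgraph_iso F V G _ (affine_A 1)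
  (fun i => if i == ord0 then u else v) (fun=> 1) ord0 sG cG.
- move=> i j; case: (eqVneq i ord0) => [->|i0]; case: (eqVneq j ord0) => [->|j0] //.
  + by move=> e; rewrite e eqxx in uv.
  + by move=> e; rewrite e eqxx in uv.
  + by move=> _; apply: val_inj; move: i0 j0; rewrite -!val_eqE /=; move: (ltn_ord i) (ltn_ord j); lia.
- move=> i j.
  by case: i => [[|[|i]] hi] //; case: j => [[|[|j]] hj] //=; rewrite -?val_eqE //= mult_sym.
- by [].
- by move=> i; rewrite (edge_graph_sum (fun=> 1)) //; case: i => [[|[|i]] hi].
by move=> iso pn; split=> //; apply: (@AffineA _ _ 1).
Qed.

Lemma chain_cat s t : chain s -> uniq t -> (forall x, x \in t -> x \notin s) -> uniq (s ++ t).
Proof.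
move=> /andP [us _] ut h; rewrite cat_uniq us ut andbT /=.
by apply/hasPn => x /h.
Qed.

Lemma nth_cat_at s t k : nth x0 (s ++ t) (size s + k) = nth x0 t k.
Proof. by rewrite nth_cat -{2}[size s]addn0 ltn_add2l addKn. Qed.

Lemma affine_D_chain s x y : chain s -> 3 <= size s ->
  x \notin s -> y \notin s -> x != y ->
  adjacent G (nth x0 s 1) x -> adjacent G (nth x0 s (size s - 2)) y ->
  affine_ADE G /\ positive_null.
Proof.
move=> cs m3 xs ys xy ax ay; set m := size s in m3 ay *.
have nx : nth x0 (s ++ [:: x; y]) m = x by rewrite -[m]addn0 nth_cat_at.
have ny : nth x0 (s ++ [:: x; y]) m.+1 = y by rewrite -addn1 nth_cat_at.
have ns k : k < m -> nth x0 (s ++ [:: x; y]) k = nth x0 s k by move=> h; rewrite nth_cat h.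
(* The null label of this diagram is 1 at the four end vertices and 2 at all
   the others. *)
have [] := @null_edges_iso m.+2 [:: (1, m), (m - 2, m.+1) & path_edges m]
  (fun i => if (0 < i) && (i < m.-1) then 2 else 1) (s ++ [:: x; y]).
- by rewrite size_cat /= addn2.
- by [].
- apply: chain_cat => //=; first by rewrite inE xy.
  by move=> z; rewrite !inE => /orP [] /eqP ->.
- apply/allP => -[i j]; rewrite !inE !xpair_eqE mem_path_edges /=; lia.
- by rewrite /= !inE uniq_path_edges !mem_path_edges !xpair_eqE; lia.
- by move=> i j; rewrite !inE !xpair_eqE !mem_path_edges; lia.
- move=> i j; rewrite !inE => /or3P [/eqP [-> ->]|/eqP [-> ->]|].
  + by rewrite nx ns //; lia.
  + by rewrite ny ns //; lia.
  + exact: path_edges_adj.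
- by move=> i _; case: ifP.
- move=> i il; rewrite !edge_sum_cons edge_sum_path /=.
  have -> : (0 < m) && (m < m.-1) = false by lia.
  have -> : (1 < m.-1) = true by lia.
  have -> : (m.+1 < m.-1) = false by lia.
  have -> : (0 < m - 2) && (m - 2 < m.-1) = true by lia.
  by do 3 (case: ifP => ?); lia.
move=> iso pn; split=> //; apply: (@AffineD _ _ m.+1); first lia.
by move: iso; rewrite /affine_D /= subSS; congr (isomorphic _ (edge_graph _ [:: _, (_, _) & _])); lia.
Qed.

(** For a concrete diagram all conditions on the labels and on the edges are
    decided by computation; what remains are the edges outside the path. *)
Lemma affine_E_chain m s t es (l : seq nat) :
  size s = m -> chain s -> uniq t -> (forall x, x \in t -> x \notin s) ->
  let n := m + size t in let es' := es ++ path_edges m in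
  size l = n -> 0 < n -> edges_below n es' -> all (fun i => 0 < i) l ->
  all (fun p => p.1 < p.2) es -> uniq es' ->
  all (fun i => edge_sum es' (nth 0 l) i == 2 * nth 0 l i) (iota 0 n) ->
  (forall i j, (i, j) \in es -> adjacent G (nth x0 (s ++ t) i) (nth x0 (s ++ t) j)) ->
  isomorphic G (edge_graph n es') /\ positive_null.
Proof.
move=> sm cs ut ts n es' sl n0 bes lpos inc ues lnull adj.
apply: (@null_edges_iso _ _ (nth 0 l) (s ++ t)) => //.
- by rewrite size_cat sm.
- exact: chain_cat.
- have lt i j : (i, j) \in es' -> i < j.
    by rewrite mem_cat => /orP [/(allP inc) //|]; rewrite mem_path_edges; lia.
  by move=> i j /lt ij; apply/negP => /lt; lia.
- by move=> i j; rewrite mem_cat -sm => /orP [/adj //|]; apply: path_edges_adj.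
- by move=> i il; apply: (allP lpos); rewrite mem_nth // sl.
- by move=> i il; apply/eqP/(allP lnull); rewrite mem_iota.
Qed.

Lemma affine_E6_chain s x y : chain s -> size s = 5 ->
  x \notin s -> y \notin s -> x != y ->
  adjacent G (nth x0 s 2) x -> adjacent G x y ->
  affine_ADE G /\ positive_null.
Proof.
move=> cs s5 xs ys xy ax ay.
have [] := @affine_E_chain 5 s [:: x; y] [:: (2, 5); (5, 6)] [:: 1; 2; 3; 2; 1; 2; 1] s5 cs => //.
- by rewrite /= inE xy.
- by move=> z; rewrite !inE => /orP [] /eqP ->.
- by move=> i j; rewrite !inE => /orP [] /eqP [-> ->]; rewrite !nth_cat s5.
by move=> iso pn; split=> //; apply: AffineE6.
Qed.

Lemma affine_E7_chain s x : chain s -> size s = 7 -> x \notin s ->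
  adjacent G (nth x0 s 3) x -> affine_ADE G /\ positive_null.
Proof.
move=> cs s7 xs ax.
have [] := @affine_E_chain 7 s [:: x] [:: (3, 7)] [:: 1; 2; 3; 4; 3; 2; 1; 2] s7 cs => //.
- by move=> z; rewrite inE => /eqP ->.
- by move=> i j; rewrite inE => /eqP [-> ->]; rewrite !nth_cat s7.
by move=> iso pn; split=> //; apply: AffineE7.
Qed.

Lemma affine_E8_chain s x : chain s -> size s = 8 -> x \notin s ->
  adjacent G (nth x0 s 2) x -> affine_ADE G /\ positive_null.
Proof.
move=> cs s8 xs ax.
have [] := @affine_E_chain 8 s [:: x] [:: (2, 8)] [:: 2; 4; 6; 5; 4; 3; 2; 1; 3] s8 cs => //.
- by move=> z; rewrite inE => /eqP ->.
- by move=> i j; rewrite inE => /eqP [-> ->]; rewrite !nth_cat s8.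
by move=> iso pn; split=> //; apply: AffineE8.
Qed.

Lemma strict_label_edges n es (d : nat -> nat) k : edges_below n es ->
  (forall i, i < n -> 0 < d i) ->
  (forall i, i < n -> edge_sum es d i <= 2 * d i) ->
  k < n -> edge_sum es d k < 2 * d k ->
  strict_label (edge_graph n es) (fun i => d i).
Proof.
move=> bes d0 dle kn dlt; split.
- by move=> i; apply: d0.
- by move=> i; rewrite edge_graph_sum // dle.
- by exists (Ordinal kn); rewrite edge_graph_sum.
Qed.

Lemma strict_label_iso (W : finType) (H : multigraph W) d :
  isomorphic G H -> strict_label H d -> exists y, strict_label G y.
Proof.
case=> f bf Hf [d0 dle [w dlt]]; exists (fun v => d (f v)).
have re v : \sum_u G v u * d (f u) = \sum_u H (f v) u * d u.
  rewrite [RHS](reindex f) /=; last exact: onW_bij.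
  by apply: eq_bigr => u _; rewrite Hf.
split=> [v|v|]; rewrite ?re //.
have [g K1 K2] := bf.
by exists (g w); rewrite re K2.
Qed.

Lemma enumerated_edges_iso n es (e : seq V) :
  (forall v, G v v = 0) -> (forall u v, G u v <= 1) ->
  size e = n -> uniq e -> (forall v, v \in e) -> uniq es ->
  (forall i j, (i, j) \in es -> i < j < n) ->
  (forall i j, i < j < n -> adjacent G (nth x0 e i) (nth x0 e j) -> (i, j) \in es) ->
  (forall i j, (i, j) \in es -> adjacent G (nth x0 e i) (nth x0 e j)) ->
  isomorphic G (edge_graph n es).
Proof.
move=> ll simple_graph se ue ce ues inc adj1 adj2.
have ie v : index v e < n by rewrite -se index_mem.
exists (fun v => Ordinal (ie v)).
  exists (fun i : 'I_n => nth x0 e i) => [v /=|i]; first by rewrite nth_index.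
  by apply: val_inj; rewrite /= index_uniq // se.
have key u v : index u e < index v e -> G u v = ((index u e, index v e) \in es).
  move=> lt.
  have := adj2 (index u e) (index v e); have := adj1 (index u e) (index v e).
  rewrite lt ie !nth_index // /adjacent; have := simple_graph u v.
  case: (G u v) => [|[|k]] // _ h1 h2; first by case: (boolP (_ \in es)) => // /h2.
  by rewrite h1.
have nedge i j : i <= j -> (j, i) \notin es by move=> ij; apply/negP => /inc; lia.
move=> u v /=; rewrite !count_uniq_mem //.
case: (ltngtP (index u e) (index v e)) => [lt|lt|eq].
- by rewrite key // (negPf (nedge _ _ (ltnW lt))) addn0.
- by rewrite mult_sym key // (negPf (nedge _ _ (ltnW lt))).
- rewrite eq (negPf (nedge _ _ (leqnn _))).
  by have -> : u = v; rewrite ?ll // -(nth_index x0 (ce u)) eq nth_index.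
Qed.

End Embedding.

Lemma strict_dynkin_A n : 1 <= n -> exists d, strict_label (dynkin_A n) d.
Proof.
move=> n1; exists (fun=> 1); apply: (@strict_label_edges _ _ (fun=> 1) 0) => //.
- by apply/allP => -[i j]; rewrite mem_path_edges /=; lia.
- by move=> i il; rewrite edge_sum_path; lia.
- by rewrite edge_sum_path; lia.
Qed.

Lemma strict_dynkin_D n : 4 <= n -> exists d, strict_label (dynkin_D n) d.
Proof.
move=> n4; exists (fun i : 'I_n => if i < n - 2 then 2 else 1).
apply: (@strict_label_edges _ _ (fun i => if i < n - 2 then 2 else 1) 0) => //.
- by apply/allP => -[i j]; rewrite !inE xpair_eqE mem_path_edges /=; lia.
- by move=> i _; case: ifP.
- move=> i il; rewrite edge_sum_cons edge_sum_path /=.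
  have -> : (n.-1 < n - 2) = false by lia.
  have -> : (n - 3 < n - 2) = true by lia.
  by do 3 (case: ifP => ?); lia.
- lia.
- rewrite edge_sum_cons edge_sum_path /=.
  have -> : (n.-1 < n - 2) = false by lia.
  have -> : (n - 3 < n - 2) = true by lia.
  by do 2 (case: ifP => ?); lia.
Qed.

Lemma strict_dynkin_E n : n \in [:: 6; 7; 8] -> exists d, strict_label (dynkin_E n) d.
Proof.
have go (l : seq nat) : size l = n ->
    edges_below n ((2, n.-1) :: path_edges n.-1) ->
    all (fun i => 0 < i) l ->
    all (fun i => edge_sum ((2, n.-1) :: path_edges n.-1) (nth 0 l) i <= 2 * nth 0 l i) (iota 0 n) ->
    0 < n -> edge_sum ((2, n.-1) :: path_edges n.-1) (nth 0 l) (n - 2) < 2 * nth 0 l (n - 2) ->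
    exists d, strict_label (dynkin_E n) d.
  move=> sl bes lpos lle n0 lt; exists (fun i : 'I_n => nth 0 l i).
  apply: (@strict_label_edges _ _ (nth 0 l) (n - 2)) => //.
  - by move=> i il; apply: (allP lpos); rewrite mem_nth // sl.
  - by move=> i il; apply: (allP lle); rewrite mem_iota.
  - by move: n0; clear; case: n => // n _; rewrite subSS; apply: leq_ltn_trans (leq_subr _ _) _.
rewrite !inE => /or3P [] /eqP en; subst n.
- exact: (go [:: 2; 4; 6; 5; 4; 3]).
- exact: (go [:: 2; 4; 6; 5; 4; 3; 3]).
- exact: (go [:: 2; 4; 6; 5; 4; 3; 2; 3]).
Qed.

Section Classification.
Variables (F : realFieldType) (V : finType) (G : multigraph V).
Hypotheses (sG : semidefinite F G) (cG : connected_graph G) (loopless : forall v, G v v = 0).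
Variable x0 : V.

Let affine := affine_ADE G /\ positive_null F G.

Lemma exit_edge (s : seq V) u w : u \in s -> w \notin s ->
  exists a b, [/\ a \in s, b \notin s & adjacent G a b].
Proof.
move=> us; have /connectP [p pp ->] := cG u w.
elim: p u us pp => [|b p IH] u us /=; first by rewrite us.
case/andP=> ub pb; case: (boolP (b \in s)) => bs; first exact: IH pb.
by move=> _; exists u, b.
Qed.

Lemma nth_segment (s : seq V) a b k : k < b -> nth x0 (take b (drop a s)) k = nth x0 s (a + k).
Proof. by move=> kb; rewrite nth_take // nth_drop. Qed.

Lemma size_segment (s : seq V) a b : a + b <= size s -> size (take b (drop a s)) = b.
Proof. by move=> h; rewrite size_takel // size_drop; lia. Qed.

Lemma notin_segment (s : seq V) a b x : x \notin s -> x \notin take b (drop a s).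
Proof. by apply: contra => /mem_take /mem_drop. Qed.

Lemma chain_rcons (s : seq V) x : chain G s -> 0 < size s -> x \notin s ->
  adjacent G (nth x0 s (size s).-1) x -> chain G (rcons s x).
Proof.
move=> /andP [us ss] s0 xs ax; rewrite /chain rcons_uniq xs us /=.
case: s s0 ss ax {us xs} => // y s _ /=; rewrite rcons_path => -> /=.
by rewrite -[size s]/((size (y :: s)).-1) nth_last.
Qed.

(** The size of a chain is at most the number of vertices. *)
Lemma longest_chain : exists2 s, chain G s /\ 0 < size s &
  forall t, chain G t -> size t <= size s.
Proof.
pose P n := [exists t : n.-tuple V, chain G t].
have Pc t : chain G t -> P (size t) by move=> ct; apply/existsP; exists (in_tuple t).
have P1 : P 1 by exact: (Pc [:: x0]).
have Pb n : P n -> n <= #|V|.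
  by case/existsP=> t /andP [ut _]; rewrite -(size_tuple t) -(card_uniqP ut) max_card.
case: (ex_maxnP (ex_intro _ 1 P1) Pb) => n /existsP [t ct] nmax.
exists t; rewrite size_tuple; first by split=> //; apply: nmax.
by move=> u /Pc /nmax.
Qed.

Section NotAffine.
Hypothesis naff : ~ affine.

Lemma simple_graph u v : G u v <= 1.
Proof.
rewrite leqNgt; apply/negP => h; apply: naff; apply: (affine_A_double sG cG _ h).
by apply/eqP => uv; rewrite uv loopless in h.
Qed.

(** A chord closes a segment of the chain to a cycle, which is an affine
    diagram. *)
Lemma no_chord s i j : chain G s -> i < j < size s ->
  adjacent G (nth x0 s i) (nth x0 s j) -> j = i.+1.
Proof.
move=> cs /andP [ij js] a; apply/eqP/negPn/negP => ne; apply: naff.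
have sz : size (take (j - i).+1 (drop i s)) = (j - i).+1 by apply: size_segment; lia.
apply: (affine_A_cycle (x0 := x0) sG cG (chain_segment i (j - i).+1 cs)); rewrite sz; first lia.
by rewrite !nth_segment //= addn0 subnKC // ltnW.
Qed.

(** Otherwise [x] and the segment from [i] to [j] form a cycle. *)
Lemma no_outer_cycle s i j x : chain G s -> i < j < size s -> x \notin s ->
  adjacent G (nth x0 s i) x -> adjacent G (nth x0 s j) x -> False.
Proof.
move=> cs /andP [ij js] xs ai aj; apply: naff.
have sz : size (take (j - i).+1 (drop i s)) = (j - i).+1 by apply: size_segment; lia.
have cc : chain G (rcons (take (j - i).+1 (drop i s)) x).
  apply: chain_rcons; rewrite ?sz ?notin_segment ?chain_segment //.
  by rewrite nth_segment //= subnKC // ltnW.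
apply: (affine_A_cycle (x0 := x0) sG cG cc); rewrite size_rcons sz; first lia.
by rewrite !nth_rcons sz /= ltnn eqxx nth_segment // addn0.
Qed.

(** Two branches at interior vertices, possibly at the same one, give an affine
    diagram of type D: keep the segment of the chain that exceeds the two
    branch points by one vertex on either side. *)
Lemma one_branch s i j x y : chain G s -> 0 < i < (size s).-1 -> 0 < j < (size s).-1 ->
  x \notin s -> y \notin s -> adjacent G (nth x0 s i) x -> adjacent G (nth x0 s j) y ->
  x = y.
Proof.
move=> cs; wlog ij : i j x y / i <= j.
  move=> W hi hj xs ys ax ay; case: (leqP i j) => ij; first exact: (W i j).
  by apply/esym; apply: (W j i) => //; apply: ltnW.
move=> hi hj xs ys ax ay; apply/eqP/negPn/negP => xy; apply: naff.
have sz : size (take (j - i + 3) (drop i.-1 s)) = j - i + 3 by apply: size_segment; lia.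
apply: (affine_D_chain (x0 := x0) sG cG (chain_segment i.-1 (j - i + 3) cs) _ _ _ xy).
- by rewrite sz; lia.
- exact: notin_segment.
- exact: notin_segment.
- by rewrite nth_segment; last lia; have -> : i.-1 + 1 = i by lia.
- by rewrite sz nth_segment; last lia; have -> : i.-1 + (j - i + 3 - 2) = j by lia.
Qed.

Lemma path_graph s : chain G s -> (forall v, v \in s) -> isomorphic G (dynkin_A (size s)).
Proof.
move=> cs ce; apply: (enumerated_edges_iso (x0 := x0) (e := s)) => //.
- exact: simple_graph.
- by case/andP: cs.
- exact: uniq_path_edges.
- by move=> i j; rewrite mem_path_edges; lia.
- by move=> i j ij a; rewrite mem_path_edges (no_chord cs ij a) eqxx -(no_chord cs ij a); lia.
- by move=> i j; rewrite -{2 3}[s]cats0; apply: path_edges_adj.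
Qed.

Lemma branch_graph s k x : chain G s -> x \notin s -> (forall v, v \in rcons s x) ->
  k < size s -> adjacent G (nth x0 s k) x ->
  isomorphic G (edge_graph (size s).+1 ((k, size s) :: path_edges (size s))).
Proof.
move=> cs xs ce ks ax.
have ns i : i < size s -> nth x0 (s ++ [:: x]) i = nth x0 s i by move=> h; rewrite nth_cat h.
have nx : nth x0 (s ++ [:: x]) (size s) = x by rewrite nth_cat ltnn subnn.
apply: (enumerated_edges_iso (x0 := x0) (e := s ++ [:: x])) => //.
- exact: simple_graph.
- by rewrite size_cat addn1.
- by rewrite cats1 rcons_uniq xs; case/andP: cs.
- by move=> v; rewrite cats1.
- by rewrite /= uniq_path_edges mem_path_edges; lia.
- by move=> i j; rewrite inE xpair_eqE mem_path_edges; lia.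
- move=> i j /andP [ij]; rewrite ltnS leq_eqVlt => /orP [/eqP ej|js].
    subst j; rewrite nx ns // => a; rewrite inE xpair_eqE eqxx andbT.
    case: (ltngtP i k) => // ik.
      by case: (@no_outer_cycle s i k x cs) => //; lia.
    by case: (@no_outer_cycle s k i x cs) => //; lia.
  rewrite !ns ?(ltn_trans ij js) // => a; have ijs : i < j < size s by lia.
  by rewrite inE mem_path_edges -(no_chord cs ijs a) eqxx js orbT.
- move=> i j; rewrite inE => /orP [/eqP [-> ->]|]; first by rewrite nx ns.
  exact: path_edges_adj.
Qed.

Section Longest.
Variable s : seq V.
Hypotheses (cs : chain G s) (smax : forall t, chain G t -> size t <= size s).

Lemma longest_end t x : chain G t -> size t = size s -> 0 < size t -> x \notin t ->
  ~~ adjacent G (nth x0 t (size t).-1) x.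
Proof.
move=> ct st t0 xt; apply/negP => a.
by have := smax (chain_rcons ct t0 xt a); rewrite size_rcons st ltnn.
Qed.

Lemma nth_rev_index k : k < size s -> nth x0 (rev s) (size s - k.+1) = nth x0 s k.
Proof. by move=> ks; rewrite nth_rev; [congr (nth _ _ _)|]; lia. Qed.

Lemma longest_interior j x : j < size s -> x \notin s -> adjacent G (nth x0 s j) x ->
  0 < j < (size s).-1.
Proof.
move=> js xs ax; apply/andP; split.
  rewrite lt0n; apply/eqP => j0; move: ax; apply/negP.
  have := @longest_end (rev s) x; rewrite size_rev mem_rev.
  have -> : (size s).-1 = size s - j.+1 by lia.
  rewrite nth_rev_index // => H; apply: H => //; [exact: chain_rev|lia].
rewrite ltn_neqAle; apply/andP; split; last lia.
apply/eqP => je; move: ax; apply/negP; rewrite je.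
by apply: longest_end => //; lia.
Qed.

(** A further vertex [y] would be attached either to the chain, against
    [one_branch], or to [x]. In the second case, if the short side of the chain
    has length 1, replacing it by [x] and [y] yields a longer chain; otherwise
    there are three arms of length 2, an affine E6. *)
Lemma longest_cover i x v : 0 < i -> i.*2 < size s -> x \notin s ->
  adjacent G (nth x0 s i) x -> v \in rcons s x.
Proof.
move=> i0 i2 xs ax; apply/negPn/negP => vn.
have im : i < size s by lia.
have xr : x \in rcons s x by rewrite mem_rcons inE eqxx.
have [b [y [bs yn aby]]] := exit_edge xr vn.
have [yx ys] : y != x /\ y \notin s.
  by move: yn; rewrite mem_rcons inE negb_or => /andP [].
move: bs; rewrite mem_rcons inE => /orP [/eqP bx|bs].
- rewrite {b}bx in aby.
  have /andP [_ il] := longest_interior im xs ax.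
  case: (ltnP i 2) => hi.
    have i1 : i = 1 by lia.
    have c1 : chain G (rev (drop 1 s)).
      by apply: chain_rev; have := chain_segment 1 (size s) cs; rewrite take_oversize // size_drop; lia.
    have z1 : size (rev (drop 1 s)) = (size s).-1 by rewrite size_rev size_drop subn1.
    have m1 z : z \notin s -> z \notin rev (drop 1 s) by rewrite mem_rev; apply: contra => /mem_drop.
    have c2 : chain G (rcons (rev (drop 1 s)) x).
      apply: chain_rcons; rewrite ?m1 ?z1 //; first lia.
      rewrite nth_rev size_drop; last lia.
      by rewrite nth_drop; have -> : 1 + (size s - 1 - (size s).-1.-1.+1) = i by lia.
    have := @longest_end _ y c2; rewrite size_rcons z1 prednK; last lia.
    rewrite mem_rcons inE negb_or yx m1 // nth_rcons z1 ltnn eqxx aby.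
    by move=> /(_ erefl) H; suff: false by []; apply: H => //; lia.
  apply: naff; have sz : size (take 5 (drop (i - 2) s)) = 5 by apply: size_segment; lia.
  apply: (affine_E6_chain (x0 := x0) sG cG (chain_segment (i - 2) 5 cs) sz
    (notin_segment _ _ xs) (notin_segment _ _ ys)) aby; first by rewrite eq_sym.
  by rewrite nth_segment // subnK.
- have jb : index b s < size s by rewrite index_mem.
  have ab : adjacent G (nth x0 s (index b s)) y by rewrite nth_index.
  have := one_branch cs (longest_interior im xs ax) (longest_interior jb ys ab) xs ys ax ab.
  by move/eqP: yx => yx /esym.
Qed.

(** The position [i] of the branch, counted from the nearer end, decides the
    type: D for 1, E for 2 as long as there is no affine E8, and an affine E7
    from 3 on. *)
Lemma longest_branch i x : 0 < i -> i.*2 < size s -> x \notin s ->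
  adjacent G (nth x0 s i) x -> finite_ADE G /\ exists y, strict_label G y.
Proof.
move=> i0 i2 xs ax; have im : i < size s by lia.
have /andP [_ il] := longest_interior im xs ax.
have cover v := longest_cover v i0 i2 xs ax.
case: (ltngtP i 2) => hi.
- have {hi i0} i1 : i = 1 by lia.
  (* The branch of [dynkin_D] sits at the far end of its path. *)
  have := @branch_graph (rev s) (size s - 2) x (chain_rev cs).
  rewrite mem_rev size_rev => /(_ xs) iso.
  have {}iso : isomorphic G (dynkin_D (size s).+1).
    rewrite /dynkin_D subSS; apply: iso.
    + by move=> v; rewrite mem_rcons inE mem_rev -in_cons -mem_rcons.
    + lia.
    + by rewrite -[2]/(1.+1) -i1 nth_rev_index.
  have n4 : 4 <= (size s).+1 by lia.
  split; first exact: FiniteD n4 iso.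
  by have [d /(strict_label_iso iso)] := strict_dynkin_D n4.
- case: naff.
  have sz : size (take 7 (drop (i - 3) s)) = 7 by apply: size_segment; lia.
  apply: (affine_E7_chain (x0 := x0) sG cG (chain_segment (i - 3) 7 cs) sz (notin_segment _ _ xs)).
  by rewrite nth_segment // subnK.
- rewrite {i0}hi in i2 im il ax.
  have s8 : size s < 8.
    rewrite ltnNge; apply/negP => h; apply: naff.
    have sz : size (take 8 (drop 0 s)) = 8 by apply: size_segment; lia.
    apply: (affine_E8_chain (x0 := x0) sG cG (chain_segment 0 8 cs) sz (notin_segment _ _ xs)).
    by rewrite nth_segment.
  have n678 : (size s).+1 \in [:: 6; 7; 8] by rewrite !inE; lia.
  have iso : isomorphic G (dynkin_E (size s).+1) by apply: branch_graph cover im ax.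
  split; first exact: FiniteE n678 iso.
  by have [d /(strict_label_iso iso)] := strict_dynkin_E n678.
Qed.

End Longest.

Lemma finite_classification : finite_ADE G /\ exists y, strict_label G y.
Proof.
have [s [cs s0] smax] := longest_chain.
case: (boolP [forall v, v \in s]) => [/forallP alls | /forallPn [w ws]].
  have iso := path_graph cs alls; split; first exact: (FiniteA s0).
  by have [d /(strict_label_iso iso)] := strict_dynkin_A s0.
have [a [x [ains xs aax]]] := exit_edge (mem_nth x0 s0) ws.
have i0 : index a s < size s by rewrite index_mem.
rewrite -(nth_index x0 ains) in aax.
have /andP [ia il] := longest_interior cs smax i0 xs aax.
case: (ltnP (index a s).*2 (size s)) => h; first exact: longest_branch ia h xs aax.
apply: (@longest_branch (rev s) _ _ (size s - (index a s).+1) x); rewrite ?size_rev ?mem_rev //.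
- exact: chain_rev.
- lia.
- lia.
- by rewrite nth_rev_index.
Qed.

End NotAffine.

(** The second component of each alternative decides whether nonzero null
    vectors exist, so that the two cases can be told apart later. *)
Theorem semidefinite_classification :
  affine_ADE G /\ positive_null F G \/ finite_ADE G /\ exists y, strict_label G y.
Proof.
have [a|na] := pselect affine; [by left | right].
exact: finite_classification.
Qed.

End Classification.

(** * Induced subgraphs and the type of a component *)

Local Open Scope ring_scope.

Section Induced.
Variables (F : realFieldType) (V : finType) (G : multigraph V) (C : {set V}).
Let W := {v : V | v \in C}.
Implicit Types (f : V -> F) (g : W -> F).

(** Extension by zero, written as a sum so that it needs no decision about the
    membership of [v]. *)
Definition extend g (v : V) : F := \sum_(u : W | val u == v) g u.

Lemma extend_val g u : extend g (val u) = g u.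
Proof. by rewrite /extend (big_pred1 u) // => w; rewrite -val_eqE. Qed.

Lemma extend_out g v : v \notin C -> extend g v = 0.
Proof.
move=> vC; rewrite /extend big_pred0 // => u.
by apply: contraNF vC => /eqP <-; apply: valP.
Qed.

Lemma sum_extend (h : V -> F) g : \sum_v h v * extend g v = \sum_u h (val u) * g u.
Proof.
rewrite [RHS](partition_big val predT) //=; apply: eq_bigr => v _.
by rewrite /extend mulr_sumr; apply: eq_bigr => u /eqP ->.
Qed.

Lemma act_extend g (u : W) : act (weight F G) (extend g) (val u) = act (weight F (induced C G)) g u.
Proof. by rewrite /act sum_extend. Qed.

Lemma semidefinite_induced : semidefinite F G -> semidefinite F (induced C G).
Proof.
move=> sG g; have := sG (extend g).
rewrite [dot (extend g) (extend g)]sum_extend dotC [dot (act _ _) _]sum_extend dotC => h.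
have -> : dot g g = \sum_u extend g (val u) * g u by apply: eq_bigr => u _; rewrite extend_val.
by apply: le_trans h; rewrite le_eqVlt; apply/orP; left; apply/eqP/eq_bigr => u _; rewrite act_extend mulrC.
Qed.

Hypothesis closed : forall u v, adjacent G u v -> u \in C -> v \in C.

Lemma no_edge_out u v : u \in C -> v \notin C -> G u v = 0%N.
Proof.
by move=> uC; apply: contraNeq; rewrite -lt0n => /closed; apply.
Qed.

Lemma null_restrict f : null_vector G f -> null_vector (induced C G) (fun u : W => f (val u)).
Proof.
move=> nf u; rewrite -nf -act_extend; apply: eq_bigr => v _.
case: (boolP (v \in C)) => vC; last by rewrite /weight no_edge_out ?(valP u) // !mul0r.
by rewrite -[v]/(val (Sub v vC : W)) extend_val.
Qed.

Lemma null_extend g : null_vector (induced C G) g -> null_vector G (extend g).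
Proof.
move=> ng v; case: (boolP (v \in C)) => vC.
  by rewrite -[v]/(val (Sub v vC : W)) extend_val act_extend ng.
rewrite extend_out // mulr0 /act sum_extend big1 // => u _.
by rewrite /weight mult_sym no_edge_out ?(valP u) // mul0r.
Qed.

Lemma extend_ge0 g v : (forall u, 0 <= g u) -> 0 <= extend g v.
Proof. by move=> g0; apply: sumr_ge0. Qed.

End Induced.

Section Supports.
Variables (F : realFieldType) (V : finType).
Implicit Types (G D : multigraph V).

(** A pointwise way to say that the component of [v] is of affine type; the
    vector is not required to live on that component only, which makes the
    property easy to transport. *)
Definition on_null G (v : V) : Prop :=
  exists f : V -> F, [/\ null_vector G f, forall u, 0 <= f u & 0 < f v].

Lemma on_null_adjacent G u v : adjacent G u v -> on_null G u -> on_null G v.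
Proof. by move=> uv [f [nf f0 fu]]; exists f; split=> //; apply: null_spread fu. Qed.

Definition commuting G D := forall u w, (\sum_v G u v * D v w = \sum_v D u v * G v w)%N.

Lemma weight_commute G D u w : commuting G D ->
  \sum_v weight F G u v * weight F D v w = \sum_v weight F D u v * weight F G v w.
Proof.
move=> c; rewrite /weight; under eq_bigr do rewrite -natrM.
by under [RHS]eq_bigr do rewrite -natrM; rewrite -!natr_sum c.
Qed.

Lemma act_commute G D (f : V -> F) v : commuting G D ->
  act (weight F G) (act (weight F D) f) v = act (weight F D) (act (weight F G) f) v.
Proof.
move=> c; have swap M N : act M (act N f) v = \sum_w (\sum_u M v u * N u w) * f w.
  rewrite /act; under eq_bigr do rewrite mulr_sumr.
  rewrite exchange_big /=; apply: eq_bigr => w _; rewrite mulr_suml.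
  by apply: eq_bigr => u _; rewrite mulrA.
by rewrite !swap; apply: eq_bigr => w _; rewrite weight_commute.
Qed.

(** If [f] is null for [G] then so is its image under the adjacency operator of
    [D], and this image is positive at the [D]-neighbours of the support. *)
Lemma on_null_transfer G D u v : commuting G D -> adjacent D u v ->
  on_null G u -> on_null G v.
Proof.
move=> c uv [f [nf f0 fu]]; exists (act (weight F D) f); split=> [w|w|].
- rewrite act_commute // /act mulr_sumr; apply: eq_bigr => x _.
  by rewrite -[\sum_y _]/(act (weight F G) f x) nf mulrCA.
- by apply: sumr_ge0 => x _; rewrite mulr_ge0 ?ler0n.
- rewrite /act (bigD1 u) //= ltr_wpDr //.
    by apply: sumr_ge0 => x _; rewrite mulr_ge0 ?ler0n.
  by rewrite mulr_gt0 // ltr0n mult_sym.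
Qed.

Lemma component_closed G v u w : adjacent G u w -> u \in component G v -> w \in component G v.
Proof. by move=> uw; rewrite !inE => vu; apply: connect_trans (connect1 uw). Qed.

Lemma component_connected G v : connected_graph (induced (component G v) G).
Proof.
set C := component G v.
have lift p (x y : {w | w \in C}) : path (adjacent G) (val x) p ->
    last (val x) p = val y -> connect (adjacent (induced C G)) x y.
  elim: p x => [|w p IH] x /=; first by move=> _ /val_inj ->.
  case/andP=> xw pp lp; have wC : w \in C := component_closed xw (valP x).
  by apply: connect_trans (connect1 _) (IH (Sub w wC) _ _).
move=> x y; have from_v (z : {w | w \in C}) : connect (adjacent G) v (val z).
  by have := valP z; rewrite inE.
have sym := @sym_connect_sym _ _ (@adjacent_sym V G).
have /connectP [p pp lp] : connect (adjacent G) (val x) (val y).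
  by apply: connect_trans (from_v y); rewrite sym.
exact: lift pp (esym lp).
Qed.

Lemma component_type G v : semidefinite F G -> (forall u, G u u = 0%N) ->
  let K := induced (component G v) G in
  (on_null G v -> affine_ADE K) /\ (~ on_null G v -> finite_ADE K).
Proof.
move=> sG ll; set C := component G v; move=> K.
have closed u w : adjacent G u w -> u \in C -> w \in C := @component_closed G v u w.
have sK : semidefinite F K := semidefinite_induced sG.
have cK : connected_graph K := @component_connected G v.
have llK (u : {w | w \in C}) : K u u = 0%N := ll (val u).
have vC : v \in C by rewrite inE connect0.
pose x0 : {w | w \in C} := Sub v vC.
case: (semidefinite_classification sK cK llK x0) => [[aff [g ng g0]]|[fin [y ly]]]; split=> //.
- case; exists (extend g); split; first exact: null_extend.
    by move=> u; apply: extend_ge0 => w; apply: ltW.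
  by rewrite -[v]/(val x0) extend_val.
- move=> [f [nf f0 fv]]; have := strict_label_null ly sK cK (null_restrict closed nf) x0.
  by move=> /= e; rewrite e ltxx in fv.
Qed.

Lemma on_null_induced G (C : {set V}) (x : {v | v \in C}) :
  (forall u v, adjacent G u v -> u \in C -> v \in C) ->
  (exists f : {v | v \in C} -> F, [/\ null_vector (induced C G) f, forall u, 0 <= f u & 0 < f x])
  <-> on_null G (val x).
Proof.
move=> closed; split=> [[g [ng g0 gx]]|[f [nf f0 fx]]].
  exists (extend g); split; first exact: null_extend.
    by move=> u; apply: extend_ge0.
  by rewrite extend_val.
by exists (fun u => f (val u)); split=> //; apply: null_restrict.
Qed.

Lemma on_null_both G D v : commuting G D ->
  (forall f : V -> F, null_vector G f -> null_vector D f -> f =1 fun=> 0) ->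
  on_null G v -> on_null D v -> False.
Proof.
move=> c none [f [nf f0 fv]] [g [ng g0 gv]].
have fg : dot f g != 0.
  rewrite gt_eqF // /dot (bigD1 v) //= ltr_wpDr ?mulr_gt0 //.
  by apply: sumr_ge0 => u _; rewrite mulr_ge0.
have [|h hn0 hnull] := common_eigenvector (weight_sym F G) (weight_sym F D) _ nf ng fg.
- by move=> u w; apply: weight_commute.
by apply: hn0; apply: none => w; case: (hnull w).
Qed.

End Supports.

(** * The two graphs of a recurrent quiver commute *)

Lemma neq_bool (a c b : bool) : a != b -> c != b -> a = c.
Proof. by case: a c b => [] [] []. Qed.

Section Commute.
Variables (V : finType) (Q : quiver V) (eps : V -> bool).
Hypothesis bip : bipartition Q eps.

Lemma same_color_no_arrow u v : eps u = eps v -> Q u v = 0%N.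
Proof. by move=> e; apply/eqP; rewrite -leqn0 leqNgt; apply/negP => /bip; rewrite e eqxx. Qed.

Lemma mutate_off (P : quiver V) v u w : u != v -> w != v ->
  mutate v P u w = (P u w + P u v * P v w - (P w u + P w v * P v u))%N.
Proof. by move=> /negPf uv /negPf wv; rewrite /= /reverse_at /add_paths uv wv. Qed.

Lemma mutate_at (P : quiver V) v u : mutate v P u v = P v u /\ mutate v P v u = P u v.
Proof.
rewrite /= /reverse_at /add_paths eqxx orbT no_loop !muln0 !addn0.
by case/orP: (no_2cycle P u v) => /eqP ->; rewrite ?subn0 ?sub0n.
Qed.

(** After mutating at the vertices of [s], all of color [b], the arrows at the
    vertices of that color outside [s] are untouched, and only the net number
    of arrows between two vertices of the other color is under control: it has
    changed by the signed number of 2-paths through [s]. The cancellation of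
    2-cycles is invisible to the net number. *)
Lemma mutate_many b (s : seq V) : uniq s -> (forall v, v \in s -> eps v = b) ->
  let P := foldr (@mutate V) Q s in
  [/\ forall x y, eps x = b -> eps y = b -> P x y = 0%N,
      forall v u, eps v = b -> v \notin s -> P u v = Q u v /\ P v u = Q v u &
      forall u w, eps u != b -> eps w != b ->
        (P u w)%:Z - (P w u)%:Z =
        \sum_(v <- s) ((Q u v * Q v w)%N%:Z - (Q w v * Q v u)%N%:Z)].
Proof.
elim: s => [|v s IH].
  split=> //; first by move=> x y ex ey; apply: same_color_no_arrow; rewrite ex.
  by move=> u w eu ew; rewrite big_nil (same_color_no_arrow (neq_bool eu ew))
       (same_color_no_arrow (neq_bool ew eu)).
rewrite cons_uniq => /andP [vs us] sb; have ev : eps v = b by apply: sb; rewrite inE eqxx.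
have [||] := IH; [by []|by move=> x xs; apply: sb; rewrite inE xs orbT|].
rewrite [foldr _ _ (v :: s)]/(mutate v (foldr (@mutate V) Q s)).
move: (foldr _ Q s) => P P1 P2 P3.
have at_ u := mutate_at P v u.
split.
- move=> x y ex ey; case: (eqVneq x v) => [->|xv]; first by have [_ ->] := at_ y; apply: P1.
  case: (eqVneq y v) => [->|yv]; first by have [-> _] := at_ x; apply: P1.
  by rewrite mutate_off // !P1 // !mul0n.
- move=> x u ex; rewrite inE negb_or => /andP [xv xs].
  have [Pux Pxu] := P2 x u ex xs.
  case: (eqVneq u v) => [uv|uv].
    by subst u; have [-> ->] := at_ x; rewrite Pux Pxu !same_color_no_arrow // ev ex.
  rewrite !mutate_off // Pux Pxu (P1 v x) // (P1 x v) // !mul0n !muln0 !addn0.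
  by case/orP: (no_2cycle Q u x) => /eqP ->; rewrite ?subn0 ?sub0n.
- move=> u w eu ew; have uv : u != v by apply: contra eu => /eqP ->; rewrite ev.
  have wv : w != v by apply: contra ew => /eqP ->; rewrite ev.
  have [Puv Pvu] := P2 v u ev vs; have [Pwv Pvw] := P2 v w ev vs.
  by rewrite !mutate_off // big_cons -P3 // Puv Pvu Pwv Pvw; lia.
Qed.

(** The opposite quiver has no arrows between vertices of the same color, so
    the net number of 2-paths vanishes. *)
Lemma recurrent_two_paths b u w : mutate_color eps b Q =2 opposite Q ->
  eps u != b -> eps w != b -> (\sum_v Q u v * Q v w = \sum_v Q w v * Q v u)%N.
Proof.
move=> rec eu ew.
have [||_ _ P3] := @mutate_many b [seq v <- enum V | eps v == b].
- by rewrite filter_uniq // enum_uniq.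
- by move=> v; rewrite mem_filter => /andP [/eqP].
have euw := neq_bool eu ew.
have := P3 u w eu ew; rewrite -/(mutate_color eps b Q) !rec /= !same_color_no_arrow // subrr.
rewrite sumrB => /esym/eqP; rewrite subr_eq0 => /eqP.
have full x y : eps x != b -> \sum_(v <- [seq v <- enum V | eps v == b]) (Q x v * Q v y)%N%:Z
    = (\sum_v Q x v * Q v y)%N%:Z :> int.
  move=> ex; rewrite big_filter big_enum_cond /= (big_morph Posz PoszD (erefl _)).
  rewrite [RHS](bigID (fun v => eps v == b)) /= [X in _ + X]big1 ?addr0 // => v vb.
  by rewrite (same_color_no_arrow (neq_bool ex vb)).
by rewrite !full // => -[].
Qed.

Lemma bigraph_mult b u v : edges_from Q eps b u v =
  if eps u == b then (if eps v == ~~ b then Q u v else 0%N) else (if eps v == b then Q v u else 0%N).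
Proof.
by rewrite /= /arrows_from; case: (eps u) (eps v) b => [] [] [] //=; rewrite ?addn0 ?add0n.
Qed.

Lemma edges_from_same_color b u v : eps u = eps v -> edges_from Q eps b u v = 0%N.
Proof.
by move=> e; rewrite bigraph_mult e; case: (eps v) b (same_color_no_arrow (esym e)) => [] [].
Qed.

(** An arrow leaving [u] belongs to the graph indexed by the color of [u], an
    arrow entering [u] to the other one. *)
Lemma edges_fromE u v : edges_from Q eps (eps u) u v = Q u v /\ edges_from Q eps (~~ eps u) u v = Q v u.
Proof.
rewrite !bigraph_mult eqxx negbK; case: (eqVneq (eps v) (eps u)) => [e|ne].
  by rewrite !same_color_no_arrow // e; case: (eps u).
by move: ne; case: (eps u) (eps v) => [] [].
Qed.

Lemma recurrent_commute : recurrent Q eps -> forall u w,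
  (\sum_v edges_from Q eps false u v * edges_from Q eps true v w =
   \sum_v edges_from Q eps true u v * edges_from Q eps false v w)%N.
Proof.
move=> [r0 r1] u w; case: (eqVneq (eps u) (eps w)) => [e|ne]; last first.
  have z b c v : (edges_from Q eps b u v * edges_from Q eps c v w = 0)%N.
    case: (eqVneq (eps u) (eps v)) => [h|h]; first by rewrite edges_from_same_color.
    have h2 : eps v = eps w by apply: (neq_bool (b := eps u)); rewrite eq_sym // ne.
    by rewrite [X in (_ * X)%N]edges_from_same_color ?muln0.
  by rewrite !big1.
have rb : mutate_color eps (~~ eps u) Q =2 opposite Q by case: (eps u).
have neb : eps u != ~~ eps u by case: (eps u).
have h := recurrent_two_paths rb neb _; have {h} : (\sum_v Q u v * Q v w = \sum_v Q w v * Q v u)%N.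
  by apply: h; rewrite -e.
under eq_bigr => v _ do
  rewrite -(edges_fromE u v).1 -(edges_fromE w v).2 (mult_sym _ w v) -e.
under [X in _ = X -> _]eq_bigr => v _ do
  rewrite -(edges_fromE w v).1 -(edges_fromE u v).2 (mult_sym _ w v) -e mulnC.
by case: (eps u) => ->.
Qed.

End Commute.

(** * Evaluating the T-system at a point *)

Section Evaluation.
Variables (A : idomainType) (F : fieldType) (ev : {rmorphism A -> F}).
Local Notation "a %:fr" := (tofrac a : {fraction A}) (at level 2, format "a %:fr").

(** The local ring of fractions whose denominator survives the evaluation [ev],
    as a relation: fractions have no canonical reduced form to evaluate. *)
Definition evaluates (x : {fraction A}) (y : F) : Prop :=
  exists a b : A, [/\ ev b != 0, x = a%:fr / b%:fr & y = ev a / ev b].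

Lemma ev_neq0 b : ev b != 0 -> b%:fr != 0.
Proof. by apply: contra; rewrite tofrac_eq0 => /eqP ->; rewrite rmorph0. Qed.

Lemma evaluates_unique x y z : evaluates x y -> evaluates x z -> y = z.
Proof.
move=> [a [b [b0 -> ->]]] [c [d [d0 e ->]]]; apply/eqP; rewrite eqr_div //.
move/eqP: e; rewrite eqr_div ?ev_neq0 // -!tofracM tofrac_eq => /eqP e.
by rewrite -!rmorphM e.
Qed.

Lemma evaluates_poly a : evaluates a%:fr (ev a).
Proof. by exists a, 1; rewrite rmorph1 oner_neq0 tofrac1 !divr1. Qed.

Lemma evaluatesD x y x' y' : evaluates x y -> evaluates x' y' -> evaluates (x + x') (y + y').
Proof.
move=> [a [b [b0 -> ->]]] [c [d [d0 -> ->]]]; exists (a * d + c * b), (b * d).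
by rewrite tofracD !tofracM rmorphD !rmorphM mulf_neq0 // !addf_div ?ev_neq0.
Qed.

Lemma evaluatesM x y x' y' : evaluates x y -> evaluates x' y' -> evaluates (x * x') (y * y').
Proof.
move=> [a [b [b0 -> ->]]] [c [d [d0 -> ->]]]; exists (a * c), (b * d).
by rewrite !tofracM !rmorphM mulf_neq0 // !mulf_div.
Qed.

Lemma evaluatesV x y : evaluates x y -> y != 0 -> evaluates x^-1 y^-1.
Proof.
move=> [a [b [b0 -> ->]]]; rewrite mulf_eq0 invr_eq0 (negPf b0) orbF => a0.
by exists b, a; rewrite a0 !invf_div.
Qed.

Lemma evaluates1 : evaluates 1 1.
Proof. by rewrite -tofrac1 -(rmorph1 ev); apply: evaluates_poly. Qed.

Lemma evaluates0 : evaluates 0 0.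
Proof. by rewrite -tofrac0 -(rmorph0 ev); apply: evaluates_poly. Qed.

Lemma evaluates_neq0 x y : evaluates x y -> y != 0 -> x != 0.
Proof.
move=> xy; apply: contra => /eqP x0; apply/eqP; rewrite x0 in xy.
exact: evaluates_unique xy evaluates0.
Qed.

Lemma evaluatesX x y n : evaluates x y -> evaluates (x ^+ n) (y ^+ n).
Proof.
move=> xy; elim: n => [|n IH]; first by rewrite !expr0; apply: evaluates1.
by rewrite !exprS; apply: evaluatesM.
Qed.

Lemma evaluates_prod (I : finType) (x : I -> {fraction A}) (y : I -> F) :
  (forall i, evaluates (x i) (y i)) -> evaluates (\prod_i x i) (\prod_i y i).
Proof. by move=> h; apply: (big_ind2 evaluates evaluates1) => //; apply: evaluatesM. Qed.

Lemma evaluates_sum (I : finType) (x : I -> {fraction A}) (y : I -> F) :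
  (forall i, evaluates (x i) (y i)) -> evaluates (\sum_i x i) (\sum_i y i).
Proof. by move=> h; apply: (big_ind2 evaluates evaluates0) => //; apply: evaluatesD. Qed.

End Evaluation.

Lemma fraction_quotient (A : idomainType) (x : {fraction A}) :
  exists a b : A, b != 0 /\ x * tofrac b = tofrac a.
Proof.
elim/quotW: x => x; exists (frac x).1, (frac x).2; split; first exact: denom_ratioP.
unlock tofrac; rewrite -[LHS]FracField.pi_mul.
apply/eqP; rewrite FracField.equivf_def /FracField.mulf.
by rewrite !numden_Ratio ?oner_neq0 // ?mulf_neq0 ?oner_neq0 ?denom_ratioP // !mulr1 mulrC.
Qed.

Lemma common_denominator (A : idomainType) (I : finType) (x : I -> {fraction A}) :
  exists (d : A) (a : I -> A), d != 0 /\ forall i, x i * tofrac d = tofrac (a i).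
Proof.
have [a] := fin_all_exists (fun i => fraction_quotient (x i)).
case/fin_all_exists => b h.
exists (\prod_i b i), (fun i => a i * \prod_(j | j != i) b j); split.
  by apply/prodf_neq0 => i _; case: (h i).
move=> i; have [_ e] := h i.
by rewrite (bigD1 i) //= !tofracM mulrA e.
Qed.

Section NonRoot.
Variable F : idomainType.

Definition drop_last n (m : multinom n.+1) : multinom n :=
  Multinom [tuple m (widen_ord (leqnSn n) i) | i < n].

Lemma drop_lastE n (m : multinom n.+1) i : drop_last m i = m (widen_ord (leqnSn n) i).
Proof. by rewrite mnmE. Qed.

Lemma drop_last_inj n (m k : multinom n.+1) :
  drop_last m = drop_last k -> m ord_max = k ord_max -> m = k.
Proof.
move=> e1 e2; apply/mnmP => i; case: (unliftP ord_max i) => [j|] -> //.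
have -> : lift ord_max j = widen_ord (leqnSn n) j by apply: val_inj; rewrite /= /bump leqNgt ltn_ord.
by rewrite -!drop_lastE e1.
Qed.

Lemma coef_muni n (p : mpoly n.+1 F) (m : multinom n.+1) :
  mcoeff (drop_last m) (muni p)`_(m ord_max) = mcoeff m p.
Proof.
rewrite muniE coef_sum raddf_sum /=.
have term k : mcoeff (drop_last m) ((mcoeff k p *: mpolyX F (drop_last k)) *: 'X^(k ord_max))`_(m ord_max)
    = mcoeff k p *+ (k == m).
  rewrite coefZ coefXn; case: (eqVneq k m) => [->|km].
    by rewrite eqxx mulr1 mcoeffZ mcoeffX eqxx mulr1.
  case: (eqVneq (m ord_max) (k ord_max)) => [e|_]; last by rewrite mulr0 mcoeff0.
  rewrite mulr1 mcoeffZ mcoeffX; case: eqP => [e2|_]; last by rewrite mulr0.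
  by case/eqP: km; apply: drop_last_inj.
under eq_bigr => k _ do rewrite term.
have [ms|ms] := boolP (m \in msupp p).
  rewrite (bigD1_seq m) ?msupp_uniq //= eqxx big1 ?addr0 // => k /negPf ->.
  by rewrite mulr0n.
rewrite (memN_msupp_eq0 ms) big_seq big1 // => k ks.
by case: eqP ks => [->|]; rewrite ?(negPf ms) ?mulr0n.
Qed.

Lemma meval_muni n (p : mpoly n.+1 F) (v : 'I_n.+1 -> F) :
  meval v p = (map_poly (meval (fun i => v (widen_ord (leqnSn n) i))) (muni p)).[v ord_max].
Proof.
rewrite muniE rmorph_sum horner_sum mevalE /=; apply: eq_bigr => m _.
rewrite -mul_polyC rmorphM /= map_polyC map_polyXn hornerM hornerC hornerXn /=.
rewrite mevalZ mevalX big_ord_recr /= mulrA; congr (_ * _ * _).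
by apply: eq_bigr => i _; rewrite drop_lastE.
Qed.

Lemma nonroot_poly (p : {poly F}) (f : nat -> F) : injective f -> p != 0 ->
  exists k, p.[f k] != 0.
Proof.
move=> fI p0; have [/allP h|] := boolP (all (root p) (map f (iota 0 (size p)))).
  have := max_poly_roots p0 (introT allP h); rewrite map_inj_uniq ?iota_uniq // size_map size_iota ltnn.
  by move/(_ isT).
by case/allPn => x /mapP [k _ ->]; exists k.
Qed.

(** Induction on the number of variables: view [p] as a polynomial in the last
    variable, make its leading coefficient nonzero, and avoid the finitely
    many roots that remain. Any infinite set of values may be prescribed for
    each coordinate. *)
Lemma nonroot_mpoly n (p : mpoly n F) (f : 'I_n -> nat -> F) :
  (forall i, injective (f i)) -> p != 0 -> exists h, meval (fun i => f i (h i)) p != 0.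
Proof.
elim: n p f => [|n IH] p f fI p0.
  exists (fun=> 0%N); move: p0; rewrite (nvar0_mpolyC p) mevalC.
  by apply: contra => /eqP ->.
have mp0 : muni p != 0.
  apply: contra p0 => /eqP e; apply/eqP/mpolyP => m.
  by rewrite -coef_muni e coef0 !mcoeff0.
have lc0 : lead_coef (muni p) != 0 by rewrite lead_coef_eq0.
have [h' hh] := IH _ (fun i => f (widen_ord (leqnSn n) i)) (fun i => fI _) lc0.
set v' := (fun i => _) in hh.
have q0 : map_poly (meval v') (muni p) != 0.
  apply: contra hh => /eqP q0; rewrite lead_coefE -coef_map q0 coef0 //.
have [k hk] := nonroot_poly (fI ord_max) q0.
exists (fun i => if unlift ord_max i is Some j then h' j else k).
rewrite meval_muni unlift_none; rewrite (eq_map_poly (g := meval v')) // => q.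
apply: meval_eq => i; rewrite /v'; congr (f _ _).
have -> : widen_ord (leqnSn n) i = lift ord_max i by apply: val_inj; rewrite /= /bump leqNgt ltn_ord.
by rewrite liftK.
Qed.

End NonRoot.

Section Trajectory.
Variables (V : finType) (Q : quiver V) (eps : V -> bool).
Hypothesis bip : bipartition Q eps.

Section Field.
Variables (F : realFieldType) (h : V -> F).

Definition step (a b : V -> F) (v : V) : F :=
  (\prod_u b u ^+ Q u v + \prod_w b w ^+ Q v w) / a v.

(** Two consecutive times. Both initial times carry the same data [h]; at each
    vertex only one of them belongs to the T-system, and the values at the
    other times form an independent trajectory that never interacts with it. *)
Fixpoint trajectory2 (k : nat) : (V -> F) * (V -> F) :=
  if k is k'.+1 then let: (a, b) := trajectory2 k' in (b, step a b) else (h, h).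

Definition trajectory (k : nat) : V -> F := (trajectory2 k).1.

Lemma trajectoryS k : trajectory k.+1 = (trajectory2 k).2.
Proof. by rewrite /trajectory /=; case: (trajectory2 k). Qed.

Lemma trajectorySS k : trajectory k.+2 = step (trajectory k) (trajectory k.+1).
Proof. by rewrite !trajectoryS /trajectory /=; case: (trajectory2 k). Qed.

Lemma trajectory_gt0 : (forall v, 0 < h v) -> forall k v, 0 < trajectory k v.
Proof.
move=> h0 k; suff : (forall v, 0 < trajectory k v) /\ (forall v, 0 < trajectory k.+1 v) by case.
elim: k => [|k [IH1 IH2]]; first by [].
split=> // v; rewrite trajectorySS /step divr_gt0 // addr_gt0 // prodr_gt0 // => u _; exact: exprn_gt0.
Qed.

End Field.

Lemma eq_trajectory (F : realFieldType) (h g : V -> F) k : h =1 g -> trajectory h k =1 trajectory g k.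
Proof.
move=> hg; suff : trajectory h k =1 trajectory g k /\ trajectory h k.+1 =1 trajectory g k.+1 by case.
elim: k => [|k [IH1 IH2]]; first by [].
split=> // v; rewrite !trajectorySS /step IH1.
congr ((_ + _) / _).
  by apply: eq_bigr => u _; rewrite IH2.
by apply: eq_bigr => u _; rewrite IH2.
Qed.

Variable T : V -> int -> ratfun V.
Hypothesis tT : is_Tsystem Q eps T.

Lemma even_atS v k : even_at eps v (k%:Z + 1) = ~~ even_at eps v k%:Z.
Proof. rewrite /even_at; lia. Qed.

Section Eval.
Variables (F : realFieldType) (ev : {rmorphism mpoly #|V| rat -> F}).
Let h v := ev (mpolyX rat (mnm1 (enum_rank v))).
Hypothesis h0 : forall v, 0 < h v.

Lemma even_at_neighbour u v k : Q u v + Q v u != 0%N -> ~~ even_at eps v k -> even_at eps u k.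
Proof.
move=> uv; have {uv} : eps u != eps v.
  have [e|//] := eqVneq (eps u) (eps v).
  by move: uv; rewrite -lt0n addn_gt0 => /orP [/bip|/bip]; rewrite e eqxx.
rewrite /even_at; case: (eps u) (eps v) => [] [] // _; lia.
Qed.

Lemma Tsystem_evaluates k v : even_at eps v k%:Z ->
  evaluates ev (T v k%:Z) (trajectory h k v).
Proof.
have [T0 Trec] := tT.
move: k v; suff H k : (forall v, even_at eps v k%:Z -> evaluates ev (T v k%:Z) (trajectory h k v)) /\
   (forall v, even_at eps v k.+1%:Z -> evaluates ev (T v k.+1%:Z) (trajectory h k.+1 v)).
  by move=> k; case: (H k).
elim: k => [|k [IH1 IH2]].
  split=> v ev_v; have := T0 v.
    have -> : eps v = false by move: ev_v; rewrite /even_at; case: (eps v).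
    by move=> ->; apply: evaluates_poly.
  have -> : eps v = true by move: ev_v; rewrite /even_at; case: (eps v).
  by move=> ->; apply: evaluates_poly.
split=> // v ev2; rewrite trajectorySS /step.
have nev : ~~ even_at eps v k.+1%:Z by move: ev2; rewrite -(addn1 k.+1) PoszD even_atS.
have ev0 : even_at eps v k%:Z by move: nev; rewrite -addn1 PoszD even_atS negbK.
have := Trec v k.+1%:Z nev.
have -> : k.+1%:Z + 1 = k.+2%:Z by lia.
have -> : k.+1%:Z - 1 = k%:Z by lia.
have yk := IH1 v ev0.
have y0 : trajectory h k v != 0 by rewrite gt_eqF // trajectory_gt0.
move/(canRL (mulfK (evaluates_neq0 yk y0))) => ->.
apply: evaluatesM; last exact: evaluatesV.
apply: evaluatesD; apply: evaluates_prod => u.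
- have [->|q0] := eqVneq (Q u v) 0%N; first by rewrite !expr0; apply: evaluates1.
  by apply/evaluatesX/IH2/(even_at_neighbour (v := v)) => //; lia.
- have [->|q0] := eqVneq (Q v u) 0%N; first by rewrite !expr0; apply: evaluates1.
  by apply/evaluatesX/IH2/(even_at_neighbour (v := v)) => //; lia.
Qed.

End Eval.
End Trajectory.

(** Only the leading coefficient is asked to be nonzero: this is enough to
    bound the sequence in the future. *)
Definition satisfies_recurrence (F : fieldType) (y : nat -> F) (S : pred nat) :=
  exists (N : nat) (c : nat -> F), c N != 0 /\
    forall k, S k -> \sum_(j < N.+1) c j * y (k + 2 * j)%N = 0.

(** Clear the denominators of the coefficients at each vertex, and evaluate at
    a point where the product of the leading coefficients does not vanish. The
    coordinates can be confined to prescribed infinite sets [f v]. *)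
Lemma integrable_trajectory (F : realFieldType) (V : finType) (Q : quiver V) (eps : V -> bool)
    (f : V -> nat -> rat) :
  bipartition Q eps -> Zamolodchikov_integrable Q eps ->
  (forall v, injective (f v)) -> (forall v k, 0 < f v k) ->
  exists h : V -> nat, forall v,
    satisfies_recurrence (fun k => trajectory Q (fun u => ratr (f u (h u)) : F) k v)
      (fun k => even_at eps v k%:Z).
Proof.
move=> bip [T tT ZT] fI f0.
have poly_rec v : exists Nc : nat * (nat -> mpoly #|V| rat), Nc.2 Nc.1 != 0 /\
    forall t : int, even_at eps v t ->
      \sum_(j < Nc.1.+1) tofrac (Nc.2 j) * T v (t + 2 * (j : nat)%:Z) = 0 :> ratfun V.
  have [N [J [_ JN rec]]] := ZT v.
  have [d [a [d0 e]]] := common_denominator J.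
  exists (N, fun j => a (inord j)); split=> /=.
    have -> : inord N = ord_max :> 'I_N.+1 by apply: val_inj; rewrite /= inordK.
    apply: contra_neq d0 => aN; apply/eqP.
    have /eqP := e ord_max; rewrite aN tofrac0 mulf_eq0 (negPf JN) /=.
    by move=> dz; rewrite -tofrac_eq0.
  move=> t et; have := congr1 (fun z => z * tofrac d) (rec t et).
  rewrite mul0r mulr_suml => rec0; apply: etrans rec0; apply: eq_bigr => j _.
  by rewrite inord_val -e mulrAC.
have [Nc {}poly_rec] := fin_all_exists poly_rec.
pose D := \prod_v (Nc v).2 (Nc v).1.
have D0 : D != 0 by apply/prodf_neq0 => v _; case: (poly_rec v).
have [h hD] := nonroot_mpoly (f := fun i => f (enum_val i)) (fun i => fI _) D0.
exists (fun v => h (enum_rank v)) => v; set y := fun k => _.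
pose ev : {rmorphism mpoly #|V| rat -> F} := ratr \o meval (fun i => f (enum_val i) (h i)).
have [lead rec] := poly_rec v.
exists (Nc v).1, (fun j => ev ((Nc v).2 j)); split.
  rewrite /ev /= fmorph_eq0; apply: contra hD => /eqP e.
  by rewrite /D rmorph_prod (bigD1 v) //= e mul0r.
move=> k ek.
have evX u : ev (mpolyX rat (mnm1 (enum_rank u))) = ratr (f u (h (enum_rank u))).
  by rewrite /ev /= mevalXU enum_rankK.
have yE j : y j = trajectory Q (fun u => ev (mpolyX rat (mnm1 (enum_rank u)))) j v.
  by apply: eq_trajectory => u; rewrite evX.
have h0 u : 0 < ev (mpolyX rat (mnm1 (enum_rank u))) by rewrite evX ltr0q.
have S : evaluates ev
    (\sum_(j < (Nc v).1.+1) tofrac ((Nc v).2 j) * T v (k%:Z + 2 * (j : nat)%:Z))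
    (\sum_(j < (Nc v).1.+1) ev ((Nc v).2 j) * y (k + 2 * j)%N).
  apply: evaluates_sum => j; apply: evaluatesM; first exact: evaluates_poly.
  have -> : k%:Z + 2 * (j : nat)%:Z = (k + 2 * j)%N%:Z by lia.
  rewrite yE; apply: (Tsystem_evaluates bip tT h0).
  by move: ek; rewrite /even_at; lia.
rewrite rec // in S; exact: evaluates_unique S (evaluates0 ev).
Qed.

(** * Growth of the evaluated T-system *)

Section Reals.
Variable F : realType.

(** The entropy of the two-point distribution (l, 1 - l). *)
Definition entropy (l : F) : F := - (l * ln l) - (1 - l) * ln (1 - l).

Lemma entropy_gt0 l : 0 < l < 1 -> 0 < entropy l.
Proof.
move=> /andP [l0 l1]; have m0 : 0 < 1 - l by lra.
have h1 : ln l < 0 by rewrite ln_lt0 // l0.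
have h2 : ln (1 - l) < 0 by rewrite ln_lt0 // m0; lra.
rewrite /entropy; nra.
Qed.

Lemma ln_leB1 (x : F) : 0 < x -> ln x <= x - 1.
Proof. by move=> x0; rewrite -{1}(subrKC 1 x) le_ln1Dx //; lra. Qed.

(** Concavity of the logarithm, in the form ln x <= x - 1 applied to
    P / (l (P + Q)) and Q / ((1 - l) (P + Q)): the weighted right-hand sides
    add up to zero. *)
Lemma ln_add l (P Q : F) : 0 < l < 1 -> 0 < P -> 0 < Q ->
  l * ln P + (1 - l) * ln Q + entropy l <= ln (P + Q).
Proof.
move=> /andP [l0 l1] P0 Q0; have m0 : 0 < 1 - l by lra.
have s0 : 0 < P + Q by rewrite addr_gt0.
have part (t X : F) : 0 < t -> 0 < X -> t * (ln X - ln (P + Q) - ln t) <= X / (P + Q) - t.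
  move=> t0 X0; have := @ln_leB1 (X / (P + Q) / t).
  rewrite !ln_div ?posrE ?divr_gt0 // => /(_ isT).
  rewrite -(ler_pM2l t0) => /le_trans; apply.
  by rewrite mulrBr mulr1 mulrC divfK ?gt_eqF.
have h1 := part l P l0 P0; have h2 := part (1 - l) Q m0 Q0.
have : P / (P + Q) + Q / (P + Q) = 1 by rewrite -mulrDl divff ?gt_eqF.
rewrite /entropy; nra.
Qed.

Lemma ln_prod (I : finType) (b : I -> F) (n : I -> nat) : (forall i, 0 < b i) ->
  ln (\prod_i b i ^+ n i) = \sum_i (n i)%:R * ln (b i).
Proof.
move=> b0; suff [] : 0 < \prod_i b i ^+ n i /\ ln (\prod_i b i ^+ n i) = \sum_i (n i)%:R * ln (b i) by [].
apply: (big_rec2 (fun x y => 0 < x /\ ln x = y)); first by rewrite ltr01 ln1.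
move=> i y x _ [x0 <-]; rewrite mulr_gt0 ?exprn_gt0 //; split=> //.
by rewrite lnM ?posrE ?exprn_gt0 // lnXn // mulr_natl.
Qed.

(** [S] stands for the times of one parity; the recurrence has step 2. *)
Lemma recurrence_growth (y : nat -> F) (S : pred nat) :
  (forall k, S k = S k.+2) -> (forall k, 0 < y k) -> satisfies_recurrence y S ->
  exists C K : F, [/\ 0 < C, 0 < K & forall k, S k -> y k <= C * K ^+ k].
Proof.
move=> S2 y0 [N [c [cN rec]]].
(* [K] dominates the coefficients solved for the last term, [C] the initial
   values. *)
pose K := 1 + \sum_(j < N) `|c j / c N|; pose C := 1 + \sum_(i < 2 * N) y i.
have K1 : 1 <= K by rewrite lerDl sumr_ge0.
have C1 : 1 <= C by rewrite lerDl sumr_ge0 // => i _; apply: ltW.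
exists C, K; split; [lra | lra |].
elim/ltn_ind => k IH Sk; have CK0 n : 0 <= C * K ^+ n by rewrite mulr_ge0 ?exprn_ge0; lra.
case: (ltnP k (2 * N)) => hk.
  apply: (@le_trans _ _ C).
    rewrite /C (bigD1 (Ordinal hk)) //= addrCA lerDl addr_ge0 // sumr_ge0 // => i _; exact: ltW.
  by rewrite ler_peMr ?exprn_ege1 //; lra.
have Sk' : S (k - 2 * N)%N.
  have S2N n j : S (n + 2 * j)%N = S n.
    by elim: j => [|j IHj]; [rewrite muln0 addn0 | rewrite mulnS addnCA add2n -S2].
  by move: Sk; rewrite -{1}(subnK hk) S2N.
have := rec _ Sk'; rewrite big_ord_recr /= subnK // => e.
have {e} -> : y k = - \sum_(j < N) (c j / c N) * y (k - 2 * N + 2 * j)%N.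
  have e2 : c N * y k = - \sum_(j < N) c j * y (k - 2 * N + 2 * j)%N.
    by apply/eqP; rewrite -addr_eq0 addrC e.
  apply: (mulfI cN); rewrite e2 mulrN mulr_sumr; congr (- _).
  by apply: eq_bigr => j _; field.
have [N0|N0] := posnP N.
  by rewrite big1 ?oppr0 // => j; have := ltn_ord j; rewrite [X in (_ < X)%N]N0.
apply: (@le_trans _ _ (\sum_(j < N) `|c j / c N| * (C * K ^+ k.-1))).
  rewrite (le_trans (ler_norm _)) // normrN (le_trans (ler_norm_sum _ _ _)) //.
  apply: ler_sum => j _; rewrite normrM ler_wpM2l ?normr_ge0 // gtr0_norm //.
  have jk : (k - 2 * N + 2 * j < k)%N by have := ltn_ord j; lia.
  apply: (le_trans (IH _ jk _)).
    have S2N n i : S (n + 2 * i)%N = S n.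
      by elim: i => [|i IHj]; [rewrite muln0 addn0 | rewrite mulnS addnCA add2n -S2].
    by rewrite S2N.
  rewrite ler_wpM2l ?ler_weXn2l //; first lra; lia.
rewrite -mulr_suml -[k in leRHS]prednK; last lia.
rewrite exprS [leRHS]mulrCA ler_wpM2r // /K; lra.
Qed.

(** The increments S(k+1) - S(k) grow by at least [c] at each step, which gives
    a quadratic lower bound. *)
Lemma convex_growth (S : nat -> F) (kappa c A B : F) : 2 <= kappa -> 0 < c ->
  0 <= S 0%N <= S 1%N -> (forall k, kappa * S k.+1 + c <= S k.+2 + S k) ->
  (forall k, S k <= A + B * k%:R) -> False.
Proof.
move=> k2 c0 /andP [S0 S1] rec bound.
have inc k : [/\ 0 <= S k, S k + c * k%:R <= S k.+1 & c * k%:R ^+ 2 <= 2 * S k + c * k%:R].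
  elim: k => [|k [IH1 IH2 IH3]]; first by split; rewrite ?mulr0 ?addr0 ?expr0n ?mulr0 //; lra.
  have kp : 0 <= k%:R :> F := ler0n _ _.
  have ck : 0 <= c * k%:R by rewrite mulr_ge0 // ltW.
  have S1' : 0 <= S k.+1 by lra.
  have := rec k; rewrite -!natr1 => r; split=> //; last nra.
  have : 2 * S k.+1 <= kappa * S k.+1 by rewrite ler_wpM2r.
  nra.
pose n := (Num.bound ((c + 2 * `|A| + 2 * `|B|) / c)).+1.
have nb : (c + 2 * `|A| + 2 * `|B|) / c < n%:R.
  apply: (lt_trans (archi_boundP _)); last by rewrite ltr_nat.
  by rewrite divr_ge0 ?addr_ge0 ?mulr_ge0 ?ler0n // ltW.
rewrite ltr_pdivrMr // in nb.
have [_ _ h] := inc n; have := bound n.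
have n1 : 1 <= n%:R :> F by rewrite ler1n.
have := ler_norm A; have := ler_norm B; have := normr_ge0 A; have := normr_ge0 B.
move: h n1 nb; move: (n%:R : F) => x; nra.
Qed.

End Reals.

Section Growth.
Variables (F : realType) (V : finType) (Q : quiver V) (eps : V -> bool).
Hypothesis bip : bipartition Q eps.
Notation Ga := (edges_from Q eps false).
Notation De := (edges_from Q eps true).

Definition mix (l : F) (u v : V) : F := l * weight F Ga u v + (1 - l) * weight F De u v.

Lemma step_edges (a b : V -> F) v : step Q a b v =
  (\prod_u b u ^+ Ga v u + \prod_u b u ^+ De v u) / a v.
Proof.
rewrite /step; have e1 u := (edges_fromE bip v u).1; have e2 u := (edges_fromE bip v u).2.
have p1 : \prod_u b u ^+ Q u v = \prod_u b u ^+ edges_from Q eps (~~ eps v) v u.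
  by apply: eq_bigr => u _; rewrite e2.
have p2 : \prod_u b u ^+ Q v u = \prod_u b u ^+ edges_from Q eps (eps v) v u.
  by apply: eq_bigr => u _; rewrite e1.
by rewrite p1 p2; case: (eps v); rewrite //= addrC.
Qed.

Variables (l kappa : F) (w : V -> F).
Hypotheses (l01 : 0 < l < 1) (w0 : forall v, 0 <= w v) (wn0 : ~ (w =1 fun=> 0)).
Hypotheses (wk : forall v, act (mix l) w v = kappa * w v) (k2 : 2 <= kappa).

Lemma mix_sym u v : mix l u v = mix l v u.
Proof. by rewrite /mix !(weight_sym F _ u v). Qed.

Lemma mix_ge0 u v : 0 <= mix l u v.
Proof. by case/andP: l01 => l0 l1; rewrite addr_ge0 // mulr_ge0 ?ler0n //; lra. Qed.

Lemma mix_same_color u v : eps u = eps v -> mix l u v = 0.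
Proof. by move=> e; rewrite /mix /weight !edges_from_same_color // !mulr0 addr0. Qed.

(* The T-system has a value at [v] and time [k] only if k + eps v is even. *)
Let wt k v : F := w v *+ even_at eps v k%:Z.

(** The two graphs are bipartite, so the eigenvector equation exchanges the
    two halves of [w]. *)
Lemma act_half k u : act (mix l) (wt k) u = kappa * wt k.+1 u.
Proof.
rewrite /wt -addn1 PoszD even_atS.
case: (boolP (even_at eps u k%:Z)) => eu /=; rewrite ?mulr0n ?mulr1n ?mulr0 -?wk.
  rewrite /act big1 // => v _; case: (boolP (even_at _ v _)) => ev; last by rewrite mulr0n mulr0.
  rewrite mix_same_color ?mul0r //; move: eu ev; rewrite /even_at.
  by case: (eps u) (eps v) => [] []; lia.
apply: eq_bigr => v _; case: (boolP (even_at _ v _)) => ev //=.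
rewrite mix_same_color ?mul0r //; move: eu ev; rewrite /even_at.
by case: (eps u) (eps v) => [] []; lia.
Qed.

Lemma wt_ge0 k v : 0 <= wt k v.
Proof. by rewrite /wt mulrn_wge0. Qed.

Let W k := \sum_v wt k v.

Lemma W_periodic k : W k.+2 = W k.
Proof.
apply: eq_bigr => v _; rewrite /wt; congr (_ *+ _); congr nat_of_bool.
Qed.

(** If one half of [w] vanished, the eigenvector equation would make the other
    half vanish too. *)
Lemma W_gt0 k : 0 < W k.
Proof.
have W0 j : 0 <= W j by apply: sumr_ge0 => v _; apply: wt_ge0.
have vanish j : W j = 0 -> forall v, wt j v = 0.
  by move=> e v; apply: (psumr_eq0P _ e) => // u _; apply: wt_ge0.
have next j : (forall v, wt j v = 0) -> forall v, wt j.+1 v = 0.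
  move=> z v; have := act_half j v; rewrite /act big1 => [|u _]; last by rewrite z mulr0.
  have kn0 : kappa != 0 by rewrite gt_eqF // (lt_le_trans _ k2).
  by move/esym/eqP; rewrite mulf_eq0 (negPf kn0) => /eqP.
rewrite lt_neqAle W0 andbT eq_sym; apply/eqP => /vanish z; apply: wn0 => v.
have := z v; have := next k z v; rewrite /wt -addn1 PoszD even_atS.
by case: (even_at _ _ _).
Qed.

Section Orbit.
Variable h : V -> F.
Hypothesis h0 : forall v, 0 < h v.
Let y := trajectory Q h.
Let S k := \sum_v wt k v * ln (y k v).

(** The logarithm of the exchange relation, bounded below by [ln_add] and
    paired with [wt k]. *)
Lemma entropy_growth k : kappa * S k.+1 + entropy l * W k <= S k.+2 + S k.
Proof.
have y0 j v : 0 < y j v by apply: trajectory_gt0.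
have wt2 v : wt k.+2 v = wt k v by rewrite /wt; congr (_ *+ _); congr nat_of_bool; rewrite /even_at; lia.
have -> : S k.+2 + S k = \sum_v wt k v * (ln (y k.+2 v) + ln (y k v)).
  by rewrite /S -big_split; apply: eq_bigr => v _; rewrite wt2 mulrDr.
have -> : kappa * S k.+1 = \sum_v wt k v * act (mix l) (fun u => ln (y k.+1 u)) v.
  rewrite -/(dot (wt k) _) dot_act; last exact: mix_sym.
  by rewrite mulr_sumr; apply: eq_bigr => v _; rewrite act_half mulrA.
rewrite mulr_sumr -big_split /=; apply: ler_sum => v _.
rewrite [entropy l * _]mulrC -mulrDr ler_wpM2l ?wt_ge0 //.
rewrite -lnM ?posrE // {2}/y trajectorySS step_edges divfK ?gt_eqF //.
apply: le_trans (ln_add l01 _ _); try by apply: prodr_gt0 => u _; apply: exprn_gt0.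
rewrite !ln_prod // lerD2r /act !mulr_sumr -big_split /=.
rewrite le_eqVlt; apply/orP; left; apply/eqP/eq_bigr => u _; rewrite /mix /weight /y /=; ring.
Qed.

Lemma trajectory_contradiction :
  (forall v, satisfies_recurrence (y^~ v) (fun k => even_at eps v k%:Z)) ->
  0 <= S 0 <= S 1 -> False.
Proof.
move=> rec S01; have y0 j v : 0 < y j v by apply: trajectory_gt0.
have bnd v : exists CK : F * F, [/\ 0 < CK.1, 0 < CK.2 &
    forall k, even_at eps v k%:Z -> y k v <= CK.1 * CK.2 ^+ k].
  have [|C [K [C0 K0 H]]] := recurrence_growth _ (fun k => y0 k v) (rec v).
    by move=> k; rewrite /even_at; lia.
  by exists (C, K).
have [CK {}bnd] := fin_all_exists bnd.
pose c := entropy l * Num.min (W 0) (W 1).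
pose A := \sum_v w v * `|ln (CK v).1|; pose B := \sum_v w v * `|ln (CK v).2|.
apply: (@convex_growth F S kappa c A B k2 _ S01).
- by rewrite mulr_gt0 ?entropy_gt0 // lt_min !W_gt0.
- move=> k; apply: le_trans (entropy_growth k); rewrite lerD2l ler_wpM2l ?(ltW (entropy_gt0 l01)) //.
  elim/ltn_ind: k => -[|[|k]] IH; last by rewrite W_periodic; apply: IH.
    by rewrite ge_min lexx.
  by rewrite ge_min lexx orbT.
- move=> k; rewrite /S /A /B mulr_suml -big_split /=; apply: ler_sum => v _.
  rewrite /wt; case: (boolP (even_at _ _ _)) => ev; last first.
    by rewrite mulr0n mul0r addr_ge0 // ?mulr_ge0.
  rewrite mulr1n -mulrA -mulrDr ler_wpM2l //.
  have [C0 K0 H] := bnd v.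
  have : ln (y k v) <= ln ((CK v).1 * (CK v).2 ^+ k).
    by rewrite ler_ln ?posrE ?mulr_gt0 ?exprn_gt0 // H.
  rewrite lnM ?posrE ?exprn_gt0 // lnXn // => /le_trans; apply.
  apply: lerD; first exact: ler_norm.
  by rewrite -[leLHS]mulr_natr ler_wpM2r ?ler_norm.
Qed.

End Orbit.

(** The initial data are generic, close to 1 where the color is 0 and beyond
    expR (W 0 / W 1) where the color is 1; so S(0) lies between 0 and W 0,
    while S(1) is at least W 0. *)
Theorem integrable_no_growth : Zamolodchikov_integrable Q eps -> False.
Proof.
move=> ZQ; pose B := (Num.bound (expR (W 0 / W 1))).+1.
pose f v (k : nat) : rat := if eps v then B%:R + k%:R else 1 + k.+1%:R^-1.
have [||h rec] := @integrable_trajectory F V Q eps f bip ZQ.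
- move=> v j k; rewrite /f; case: (eps v) => /addrI.
    by move/eqP; rewrite eqr_nat => /eqP.
  by move/invr_inj/eqP; rewrite eqr_nat => /eqP [].
- move=> v k; rewrite /f; case: (eps v); first by rewrite -natrD ltr0n.
  by rewrite addr_gt0 // invr_gt0 ltr0n.
pose g v : F := ratr (f v (h v)).
have g0 v : 0 < g v.
  rewrite ltr0q /f; case: (eps v); first by rewrite -natrD ltr0n.
  by rewrite addr_gt0 // invr_gt0 ltr0n.
apply: (trajectory_contradiction g0 rec).
have g1 v : 1 <= g v.
  rewrite -(rmorph1 (ratr : rat -> F)) ler_rat /f; case: (eps v); last by rewrite lerDl invr_ge0.
  by rewrite -natrD ler1n.
have small v : eps v = false -> ln (g v) <= 1.
  move=> ev; apply: le_trans (ln_leB1 (g0 v)) _; rewrite lerBlDl /g /f ev.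
  rewrite rmorphD rmorph1 lerD2l fmorphV rmorph_nat invf_le1 ?ltr0n //.
  by rewrite ler1n.
have big v : eps v = true -> W 0 / W 1 <= ln (g v).
  move=> ev; rewrite -[W 0 / W 1]expRK ler_ln ?posrE ?expR_gt0 //.
  rewrite /g /f ev rmorphD !rmorph_nat (le_trans (ltW (archi_boundP (expR_ge0 _)))) //.
  by rewrite -natrD ler_nat /B; lia.
apply/andP; split.
  by apply: sumr_ge0 => v _; rewrite mulr_ge0 ?wt_ge0 // ln_ge0.
apply: (@le_trans _ _ (W 0)).
  apply: ler_sum => v _; rewrite /wt /even_at; case: (boolP (_ %| _)%Z) => ev; last by rewrite mulr0n mul0r.
  by rewrite mulr1n ler_piMr //= small //; move: ev; case: (eps v).
rewrite -[leLHS](divfK (lt0r_neq0 (W_gt0 1))) mulr_sumr; apply: ler_sum => v _.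
rewrite mulrC /wt /even_at; case: (boolP (_ %| _)%Z) => ev; last by rewrite mulr0n !mul0r.
by rewrite mulr1n ler_wpM2l //= big //; move: ev; case: (eps v).
Qed.

End Growth.

(** * The classification *)

Section Integrable.
Variables (F : realType) (V : finType) (Q : quiver V) (eps : V -> bool).
Hypotheses (bip : bipartition Q eps) (ZQ : Zamolodchikov_integrable Q eps).
Notation E b := (edges_from Q eps b).

Lemma mix_form_lt l (f : V -> F) : 0 < l < 1 -> ~ (f =1 fun=> 0) ->
  l * dot f (act (weight F (E false)) f) + (1 - l) * dot f (act (weight F (E true)) f) < 2 * dot f f.
Proof.
move=> l01 fn0; rewrite ltNge; apply/negP => h.
have h2 : 2 * dot f f <= dot f (act (mix Q eps l) f).
  apply: le_trans h _; rewrite le_eqVlt; apply/orP; left; apply/eqP.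
  rewrite /dot !mulr_sumr -big_split /=; apply: eq_bigr => v _.
  have -> : act (mix Q eps l) f v =
      l * act (weight F (E false)) f v + (1 - l) * act (weight F (E true)) f v.
    by rewrite /act !mulr_sumr -big_split; apply: eq_bigr => u _; rewrite /mix /=; ring.
  ring.
have [kappa [w [k2 w0 wn0 wk]]] := perron (mix_sym _ _ _) (mix_ge0 Q eps l01) fn0 h2.
exact: (integrable_no_growth bip l01 w0 wn0 wk k2 ZQ).
Qed.

Lemma abs_neq0 (f : V -> F) : ~ (f =1 fun=> 0) -> ~ ((fun v => `|f v|) =1 fun=> 0).
Proof. by move=> fn0 z; apply: fn0 => v; apply/eqP; rewrite -normr_eq0 z. Qed.

(** If the form of one graph exceeds 2 at a vector, it does so at a nonnegative
    vector, where the other form is nonnegative; then a mixture with [l] close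
    to 1 still reaches 2. *)
Lemma integrable_semidefinite b : semidefinite F (E b).
Proof.
move=> f; have [f0|fn0] := pselect (f =1 fun=> 0).
  by rewrite /dot !big1 ?mulr0 // => v _; rewrite f0 mul0r.
rewrite leNgt; apply/negP => h.
pose g v := `|f v|; have gn0 : ~ (g =1 fun=> 0) := abs_neq0 fn0.
have g0 := dot_gt0 gn0; have := dot_abs f; rewrite -/g => gf; rewrite -gf in h.
have mixed c l : 0 < l < 1 -> l * dot g (act (weight F (E c)) g) +
    (1 - l) * dot g (act (weight F (E (~~ c))) g) < 2 * dot g g.
  case: c => l01 /=; last exact: mix_form_lt.
  have m01 : 0 < 1 - l < 1 by move/andP: l01 => []; lra.
  by have := mix_form_lt m01 gn0; lra.
have w0 c u v : 0 <= weight F (E c) u v by rewrite ler0n.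
have a2 : 2 * dot g g < dot g (act (weight F (E b)) g).
  exact: lt_le_trans h (dot_act_abs _ (w0 b)).
have c0 : 0 <= dot g (act (weight F (E (~~ b))) g).
  by apply: sumr_ge0 => v _; rewrite mulr_ge0 ?normr_ge0 // sumr_ge0 // => u _; rewrite mulr_ge0 ?normr_ge0.
set a := dot g (act (weight F (E b)) g) in a2.
have a0 : 0 < a by lra.
(* The choice for which the contribution of the first form alone is 2. *)
pose l := 2 * dot g g / a.
have l01 : 0 < l < 1.
  by rewrite divr_gt0 //=; [rewrite ltr_pdivrMr // mul1r | lra].
have la : l * a = 2 * dot g g by rewrite divfK // gt_eqF.
have c1 : 0 <= (1 - l) * dot g (act (weight F (E (~~ b))) g).
  by rewrite mulr_ge0 //; case/andP: l01; lra.
by have := mixed b l l01; rewrite -/a la; lra.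
Qed.

(** At a common null vector all the mixtures take the value 2, against
    [mix_form_lt] for l = 1/2. *)
Lemma integrable_no_common_null (f : V -> F) :
  null_vector (E false) f -> null_vector (E true) f -> f =1 fun=> 0.
Proof.
move=> n0 n1; have [//|fn0] := pselect (f =1 fun=> 0).
have h : 0 < (2^-1 : F) < 1 by apply/andP; split; lra.
have := mix_form_lt h fn0; rewrite !null_isotropic //; have := dot_gt0 fn0; lra.
Qed.

End Integrable.

Lemma multigraph_ext (V : finType) (G H : multigraph V) : (forall u v, G u v = H u v) -> G = H.
Proof.
case: G H => g gs [h hs] /= gh.
have e : g = h by apply/funext => u; apply/funext => v.
by subst h; congr Multigraph; apply: Prop_irrelevance.
Qed.

Section Component.
Variables (F : realFieldType) (V : finType) (G : multigraph V) (C : {set V}).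
Hypotheses (sG : semidefinite F G) (ll : forall v, G v v = 0%N).
Hypothesis closed : forall u v, adjacent G u v -> u \in C -> v \in C.

Lemma all_affine : (forall v, v \in C -> on_null F G v) ->
  all_components affine_ADE (induced C G).
Proof.
move=> h x; have [H _] := component_type x (semidefinite_induced sG) (fun u => ll (val u)).
by apply: H; apply/(on_null_induced F x closed)/h/valP.
Qed.

Lemma all_finite : (forall v, v \in C -> ~ on_null F G v) ->
  all_components finite_ADE (induced C G).
Proof.
move=> h x; have [_ H] := component_type x (semidefinite_induced sG) (fun u => ll (val u)).
by apply: H => /(on_null_induced F x closed); apply: h; apply: valP.
Qed.

End Component.

Lemma commuting_induced (V : finType) (C : {set V}) (B : bigraph {v | v \in C}) (G D : multigraph V) :
  commuting G D -> Gam B = induced C G -> Del B = induced C D ->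
  (forall u v, adjacent G u v -> u \in C -> v \in C) ->
  (forall u v, adjacent D u v -> u \in C -> v \in C) -> commuting_bigraph B.
Proof.
move=> c eG eD cG cD; rewrite /commuting_bigraph eG eD; apply/matrixP => i j; rewrite !mxE.
have sub (H K : multigraph V) (cH : forall u v, adjacent H u v -> u \in C -> v \in C) :
   \sum_k adjacency_matrix (induced C H) i k * adjacency_matrix (induced C K) k j =
   (\sum_v H (val (enum_val i)) v * K v (val (enum_val j)))%N%:Z.
  rewrite (reindex enum_rank) /=; last by apply: onW_bij; apply: enum_rank_bij.
  under eq_bigr do rewrite !mxE enum_rankK /=.
  rewrite (big_morph Posz PoszD (erefl _)) (bigID (mem C)) /= [X in _ + X]big1 ?addr0; last first.
    by move=> v vC; rewrite (no_edge_out cH) ?(valP (enum_val i)).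
  by rewrite [RHS]big_sub; apply: eq_bigr => u _; rewrite PoszM.
by rewrite !sub // c.
Qed.

Theorem theorem1p2p5 (V : finType) (Q : quiver V) (eps : V -> bool) :
  bipartition Q eps ->
  recurrent Q eps ->
  Zamolodchikov_integrable Q eps ->
  exists2 eps' : V -> bool, bipartition Q eps' &
    forall v : V,
      let K := bigraph_component (quiver_bigraph Q eps') v in
      admissible_ADE_bigraph K \/ affine_finite_ADE_bigraph K.
Proof.
move=> bip rec ZQ; pose R : realType := Rdefinitions.R.
pose E b := edges_from Q eps b.
have comm b : commuting (E b) (E (~~ b)).
  by case: b => u w; rewrite /E /= (recurrent_commute bip rec).
have semi b : semidefinite R (E b) := integrable_semidefinite bip ZQ b.
have ll b v : E b v v = 0%N by apply: edges_from_same_color.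
have arrow b u v : adjacent (E b) u v -> (0 < Q u v + Q v u)%N.
  rewrite /adjacent /E bigraph_mult; case: (eps u == b); case: (_ == _) => //; lia.
have both b v : on_null R (E b) v -> ~ on_null R (E (~~ b)) v.
  move=> h1 h2; apply: (on_null_both (comm false) (v := v)).
  - by move=> f n0 n1; apply: (integrable_no_common_null bip ZQ n0 n1).
  - by case: b h1 h2.
  - by case: b h1 h2.
have spread b u v : (0 < Q u v + Q v u)%N -> on_null R (E b) u -> on_null R (E b) v.
  move=> uv; have : adjacent (E b) u v \/ adjacent (E (~~ b)) u v.
    have [e1 e2] := edges_fromE bip u v; rewrite /adjacent /E.
    have [->|->] : b = eps u \/ b = ~~ eps u by case: (b) (eps u) => [] []; auto.
      by rewrite e1 e2; lia.
    by rewrite negbK e1 e2; lia.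
  case; first exact: on_null_adjacent.
  by apply: on_null_transfer; apply: comm.
(* Exchange the colors where Delta is affine; this is constant along arrows. *)
pose eps' u := eps u (+) `[< on_null R (E true) u >].
have sw u v : (0 < Q u v + Q v u)%N ->
    `[< on_null R (E true) u >] = `[< on_null R (E true) v >].
  by move=> uv; apply/asboolP/asboolP; apply: spread => //; rewrite addnC.
have bip' : bipartition Q eps'.
  move=> u v uv; rewrite /eps' (sw u v); last by lia.
  by have := bip u v uv; case: (eps u) (eps v) `[< _ >] => [] [] [].
exists eps' => // v K.
pose C := component (bigraph_union (quiver_bigraph Q eps')) v.
have adjU u w : adjacent (bigraph_union (quiver_bigraph Q eps')) u w = (0 < Q u w + Q w u)%N.
  rewrite /adjacent -[bigraph_union _ u w]/(edges_from Q eps' false u w + edges_from Q eps' true u w)%N.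
  by have [e1 e2] := edges_fromE bip' u w; case: (eps' u) e1 e2 => /= -> ->; rewrite addnC.
have closedU u w : (0 < Q u w + Q w u)%N -> u \in C -> w \in C.
  by rewrite -adjU; apply: component_closed.
have closed b u w : adjacent (E b) u w -> u \in C -> w \in C by move/arrow; apply: closedU.
have uniform (P : V -> Prop) : (forall u w, (0 < Q u w + Q w u)%N -> P u -> P w) ->
    P v -> forall u, u \in C -> P u.
  move=> Pspread Pv u; rewrite inE => /connectP [p pp ->].
  elim: p (v) Pv pp => //= w p IH x Px /andP [xw pp]; apply: IH pp.
  by apply: Pspread Px; rewrite -adjU.
pose b := `[< on_null R (E true) v >].
have swC u : u \in C -> `[< on_null R (E true) u >] = b.
  by apply: (uniform (fun u => `[< on_null R (E true) u >] = b)) => // x w xw <-; rewrite (sw x w xw).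
have edge c : induced C (edges_from Q eps' c) = induced C (E (c (+) b)).
  apply: multigraph_ext => -[u uC] [w wC] /=.
  rewrite /arrows_from /eps' !swC //.
  by move: (b) => b0; case: (eps u) (eps w) c b0 => [] [] [] [].
have nullC c u : u \in C -> on_null R (E c) u -> forall w, w \in C -> on_null R (E c) w.
  move=> uC nu; have nv : on_null R (E c) v.
    apply: contrapT => nv; move: nu; apply: (uniform (fun u => ~ on_null R (E c) u)) => // x y xy nx ny.
    by apply: nx; apply: spread ny; rewrite addnC.
  by apply: (uniform (on_null R (E c))) nv; apply: spread.
have vC : v \in C by rewrite inE connect0.
have finD : forall u, u \in C -> ~ on_null R (E (~~ b)) u.
  move=> u uC; case: (boolP b) => [/asboolP hb|/asboolP nb] nu.
    by apply: (both true u) => //; apply: nullC hb _ uC.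
  by apply: nb; apply: nullC nu _ vC.
have bK : bipartite_bigraph K.
  exists (fun u => eps' (val u)) => u w; apply: contraTneq => /= e.
  have z c : edges_from Q eps' c (val u) (val w) = 0%N by apply: edges_from_same_color.
  by rewrite /adjacent negb_or -!leqNgt !leqn0; apply/andP; split; apply/eqP; apply: z.
have eG : Gam K = induced C (E b) := edge false.
have eD : Del K = induced C (E (~~ b)) := edge true.
have cK : commuting_bigraph K := commuting_induced (comm b) eG eD (closed b) (closed (~~ b)).
have dK : all_components finite_ADE (Del K).
  by rewrite eD; apply: all_finite (semi _) (ll _) (closed _) finD.
have [nv|nv] := pselect (on_null R (E b) v); [right|left]; split=> //; rewrite eG.
  by apply: all_affine (semi _) (ll _) (closed _) _; apply: nullC nv.
by apply: all_finite (semi _) (ll _) (closed _) _ => u uC nu; apply: nv; apply: nullC nu _ vC.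
Qed.
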